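(* For every integer $n\ge 2$, the group $F_n$ contains a maximal subgroup of infinite index which does not fix any point of $(0,1)$ (i.e. no point of $(0,1)$ is fixed by all elements of the subgroup). Moreover, the subgroup can be chosen to be isomorphic to $F_{2n-1}$.
   Context: For $m\ge2$, $F_m$ is the group (under composition) of all piecewise-linear homeomorphisms of $[0,1]$ with finitely many breakpoints, all in $\mathbb Z[\frac1m]$, and with all slopes integer powers of $m$. A maximal subgroup is a proper subgroup not contained in any other proper subgroup. *)

(* Defs.v *)
From HB Require Import structures.
From mathcomp Require Import all_boot all_order all_algebra.
From mathcomp Require Import all_classical all_reals all_analysis.
From mathcomp Require Import ring lra.

Set Implicit Arguments.
Unset Strict Implicit.
Unset Printing Implicit Defensive.

Import Order.TTheory GRing.Theory Num.Theory.
Import numFieldNormedType.Exports.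

Local Open Scope classical_set_scope.
Local Open Scope ring_scope.

Definition is_homeo (T : topologicalType) (f : T -> T) : Prop :=
  exists g : T -> T, [/\ cancel f g, cancel g f, continuous f & continuous g].

Record homeo (T : topologicalType) : Type := Homeo {
  homeo_fun :> T -> T;
  homeoP : is_homeo homeo_fun }.

Section HomeoGroup.
Context {T : topologicalType}.
Implicit Types f g : homeo T.

Lemma homeo_eqP f g : (forall x, f x = g x) -> f = g.
Proof.
case: f g => [f fP] [g gP] /= fg; have {}fg : f = g by apply/funext.
by subst g; congr Homeo; exact: Prop_irrelevance.
Qed.

HB.instance Definition _ := gen_eqMixin (homeo T).
HB.instance Definition _ := gen_choiceMixin (homeo T).

Definition homeo_inv_fun f : T -> T := projT1 (cid (homeoP f)).

Lemma homeo_funK f : cancel f (homeo_inv_fun f).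
Proof. by rewrite /homeo_inv_fun; case: cid => g []. Qed.

Lemma homeo_inv_funK f : cancel (homeo_inv_fun f) f.
Proof. by rewrite /homeo_inv_fun; case: cid => g []. Qed.

Lemma is_homeo_id : is_homeo (@id T).
Proof. by exists id; split=> // x; exact: cvg_id. Qed.

Lemma is_homeo_comp f g : is_homeo (f \o g).
Proof.
case: (homeoP f) (homeoP g) => [f' [fK f'K cf cf']] [g' [gK g'K cg cg']].
exists (g' \o f'); split; [exact: can_comp | exact: can_comp | |].
- by move=> x; apply: continuous_comp; [exact: cg | exact: cf].
- by move=> x; apply: continuous_comp; [exact: cf' | exact: cg'].
Qed.

Lemma is_homeo_inv f : is_homeo (homeo_inv_fun f).
Proof.
rewrite /homeo_inv_fun; case: cid => g [fK gK cf cg] /=.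
by exists f; split.
Qed.

Definition homeo_one : homeo T := Homeo is_homeo_id.
Definition homeo_mul f g : homeo T := Homeo (is_homeo_comp f g).
Definition homeo_inv f : homeo T := Homeo (is_homeo_inv f).

Lemma homeo_mulA : associative homeo_mul.
Proof. by move=> f g h; exact: homeo_eqP. Qed.
Lemma homeo_mul1 : left_id homeo_one homeo_mul.
Proof. by move=> f; exact: homeo_eqP. Qed.
Lemma homeo_mulr1 : right_id homeo_one homeo_mul.
Proof. by move=> f; exact: homeo_eqP. Qed.
Lemma homeo_mulV : left_inverse homeo_one homeo_inv homeo_mul.
Proof. by move=> f; apply: homeo_eqP => x; exact: homeo_funK. Qed.
Lemma homeo_mulrV : right_inverse homeo_one homeo_inv homeo_mul.
Proof. by move=> f; apply: homeo_eqP => x; exact: homeo_inv_funK. Qed.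

HB.instance Definition _ := isGroup.Build (homeo T)
  homeo_mulA homeo_mul1 homeo_mulr1 homeo_mulV homeo_mulrV.

End HomeoGroup.

(* As a type, [unit_itv R] is the sigma type of its elements, with the topology
   induced by that of [R]. *)
Definition unit_itv (R : realType) : set R := `[0, 1]%classic.
Arguments unit_itv R : clear implicits.

(* The ring Z[1/m], as a subset of R. *)
Definition Zinv (R : realType) (m : nat) : set R :=
  [set x | exists (a : int) (k : nat), x = a%:~R / m%:R ^+ k].

(* [f] is affine, with slope an integer power of [m], on every interval of
   [0, 1] whose interior misses [B]; in particular all breakpoints of [f] are
   in [B]. *)
Definition pl_with_breaks (R : realType) (m : nat) (B : seq R)
    (f : unit_itv R -> unit_itv R) : Prop :=
  forall u v : unit_itv R, \val u < \val v ->
    (forall b, b \in B -> ~ (\val u < b < \val v)) ->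
  exists (e : int) (c : R), forall x : unit_itv R,
    \val u <= \val x <= \val v -> \val (f x) = m%:R ^ e * \val x + c.

Definition is_brown_thompson (R : realType) (m : nat)
    (f : homeo (unit_itv R)) : Prop :=
  exists B : seq R,
    (forall b, b \in B -> Zinv m b) /\ pl_with_breaks m B f.

Section ZinvTheory.
Context {R : realType} (m : nat).

Lemma Zinv_int (x : R) : m = 0%N -> Zinv m x <-> exists a : int, x = a%:~R.
Proof.
move=> ->; split=> [[a [[|k] ->]]|[a ->]].
- by exists a; rewrite expr0 divr1.
- by exists 0; rewrite exprS mul0r invr0 mulr0.
- by exists a, 0%N; rewrite expr0 divr1.
Qed.

Lemma ZinvB (x y : R) : Zinv m x -> Zinv m y -> Zinv m (x - y).
Proof.
have [m0|m0] := eqVneq m 0%N.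
  rewrite !(Zinv_int _ m0) => -[a ->] [b ->]; exists (a - b).
  by rewrite rmorphB.
move=> [a [k ->]] [b [l ->]].
exists (a * m%:Z ^+ l - b * m%:Z ^+ k), (k + l)%N.
have mR : m%:R != 0 :> R by rewrite pnatr_eq0.
have mk : m%:R ^+ k != 0 :> R by rewrite expf_neq0.
have ml : m%:R ^+ l != 0 :> R by rewrite expf_neq0.
rewrite rmorphB !rmorphM !rmorphXn /= -!pmulrn exprD.
by field; rewrite mk ml.
Qed.

Lemma Zinv0 : Zinv m (0 : R).
Proof. by exists 0, 0%N; rewrite mul0r. Qed.

Lemma ZinvD (x y : R) : Zinv m x -> Zinv m y -> Zinv m (x + y).
Proof.
move=> mx my; rewrite -[y]opprK; apply: ZinvB => //.
by rewrite -[- y]add0r; apply: ZinvB => //; exact: Zinv0.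
Qed.

Lemma Zinv_scale (e : int) (x : R) :
  (m%:R : R) ^ e != 0 -> Zinv m x -> Zinv m (m%:R ^ e * x).
Proof.
have [-> |m0] := eqVneq m 0%N.
  by rewrite exp0rz; case: (e == 0); rewrite /= ?mulr0z ?eqxx // mulr1z mul1r.
move=> _ [a [k ->]]; have mR : m%:R != 0 :> R by rewrite pnatr_eq0.
case: e => n.
  exists (a * m%:Z ^+ n), k; rewrite rmorphM rmorphXn /= -pmulrn.
  by rewrite mulrCA mulrA.
exists a, (k + n.+1)%N; rewrite NegzE -exprnN exprD.
by rewrite invfM mulrC mulrA.
Qed.

Lemma expz_neq0D (e e' : int) : (m%:R : R) ^ e != 0 -> (m%:R : R) ^ e' != 0 ->
  (m%:R : R) ^ e * m%:R ^ e' = m%:R ^ (e + e').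
Proof.
have [-> |m0] := eqVneq m 0%N; last first.
  by move=> _ _; rewrite expfzDr // pnatr_eq0.
have e0 (d : int) : (0%:R : R) ^ d != 0 -> d = 0.
  by rewrite exp0rz; have [-> //|] := eqVneq d 0; rewrite /= ?mulr0z ?eqxx.
by move=> /e0 -> /e0 ->; rewrite addr0 !expr0z mulr1.
Qed.

End ZinvTheory.

Section PLTheory.
Context {R : realType} (m : nat) (B : seq R) (f : homeo (unit_itv R)).
Notation I := (unit_itv R : Type).
Hypothesis BZ : forall b, b \in B -> Zinv m b.
Hypothesis fB : pl_with_breaks m B f.
Implicit Types u v x : unit_itv R.

Lemma unit_itvP x : 0 <= \val x <= 1.
Proof. by have /set_mem := valP x; rewrite /unit_itv /= in_itv /=. Qed.

Lemma unit_itv_lift (r : R) : 0 <= r <= 1 -> exists x, \val x = r.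
Proof.
move=> r01; have rI : r \in unit_itv R by rewrite inE /unit_itv /= in_itv.
by exists (exist _ r rI).
Qed.

Lemma homeo_inj : injective f.
Proof. exact: can_inj (homeo_funK f). Qed.

Lemma pl_slope u v : \val u < \val v ->
    (forall b, b \in B -> ~ (\val u < b < \val v)) ->
  exists (e : int) (c : R), (0 < (m%:R : R) ^ e) /\
    forall x, \val u <= \val x <= \val v -> \val (f x) = m%:R ^ e * \val x + c.
Proof.
move=> uv guv; have [e [c fE]] := fB uv guv; exists e, c; split=> //.
rewrite lt_neqAle exprz_ge0 ?ler0n // andbT eq_sym; apply/eqP => s0.
have := fE u; have := fE v; rewrite !lexx (ltW uv) s0 !mul0r => fv fu.
have /val_inj/homeo_inj uvE : \val (f u) = \val (f v) by rewrite fu // fv.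
by move: uv; rewrite uvE ltxx.
Qed.

Lemma gap_ind (P : unit_itv R -> unit_itv R -> Prop) :
  (forall u v, \val u < \val v ->
    (forall b, b \in B -> ~ (\val u < b < \val v)) -> P u v) ->
  (forall u w v, \val u < \val w -> \val w < \val v -> \val w \in B ->
    P u w -> P w v -> P u v) ->
  forall u v, \val u < \val v -> P u v.
Proof.
move=> Pgap Psplit.
have H : forall (B0 : seq R) u v, \val u < \val v ->
    (forall b, b \in B -> \val u < b < \val v -> b \in B0) -> P u v.
  elim=> [|b B0 IH] u v uv sub.
    by apply: Pgap => // b bB buv; have := sub _ bB buv; rewrite in_nil.
  have [/andP[bB /andP[ub bv]]|nb] := boolP ((b \in B) && (\val u < b < \val v)).
    have [|w wb] := @unit_itv_lift b.
      by have := unit_itvP u; have := unit_itvP v; lra.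
    rewrite -wb in bB ub bv sub.
    apply: (Psplit u w v) => //; apply: IH => // b' b'B /andP[ub' b'v].
    - have := sub _ b'B; rewrite ub' (lt_trans b'v bv) inE => /(_ isT).
      by case/predU1P=> // b'E; rewrite b'E ltxx in b'v.
    - have := sub _ b'B; rewrite b'v (lt_trans ub ub') inE => /(_ isT).
      by case/predU1P=> // b'E; rewrite b'E ltxx in ub'.
  apply: IH => // b' b'B b'uv; have := sub _ b'B b'uv; rewrite inE.
  by case/predU1P=> // b'E; move: nb; rewrite -b'E b'B b'uv.
by move=> u v uv; exact: (H B).
Qed.

Lemma pl_lt u v : \val u < \val v -> \val (f u) < \val (f v).
Proof.
move: u v; apply: gap_ind => [u v uv guv|u w v _ _ _]; last exact: lt_trans.
have [e [c [e0 fE]]] := pl_slope uv guv.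
by rewrite !fE ?lexx ?(ltW uv) // ltrD2r ltr_pM2l.
Qed.

Lemma pl_ltE u v : (\val (f u) < \val (f v)) = (\val u < \val v).
Proof.
have [uv|vu|uv] := ltgtP (\val u) (\val v); first exact: pl_lt.
  by apply: lt_gtF; exact: pl_lt.
by rewrite (val_inj uv) ltxx.
Qed.

Lemma pl_leE u v : (\val (f u) <= \val (f v)) = (\val u <= \val v).
Proof. by rewrite !leNgt pl_ltE. Qed.

Lemma pl_Zinv_diff u v : \val u < \val v -> Zinv m (\val u) ->
  (Zinv m (\val v) <-> Zinv m (\val (f v) - \val (f u))).
Proof.
move: u v; apply: gap_ind => [u v uv guv uZ|u w v uw wv wB IH1 IH2 uZ].
  have [e [c [e0 fE]]] := pl_slope uv guv.
  rewrite !fE ?lexx ?(ltW uv) //.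
  have -> : m%:R ^ e * \val v + c - (m%:R ^ e * \val u + c) =
            m%:R ^ e * (\val v - \val u) by ring.
  split=> [vZ|]; first by apply: Zinv_scale; [exact: lt0r_neq0|exact: ZinvB].
  move=> /(@Zinv_scale R m (- e)); rewrite -invr_expz invr_eq0.
  rewrite (lt0r_neq0 e0) => /(_ isT).
  by rewrite mulKf ?lt0r_neq0 // => /ZinvD/(_ uZ); rewrite subrK.
have wZ : Zinv m (\val w) by exact: BZ.
have fwZ := (IH1 uZ).1 wZ.
split=> [vZ|fZ].
  have -> : \val (f v) - \val (f u) =
     (\val (f v) - \val (f w)) + (\val (f w) - \val (f u)) by ring.
  by apply: ZinvD => //; apply/(IH2 wZ).1.
apply/(IH2 wZ).2.
have -> : \val (f v) - \val (f w) =
   (\val (f v) - \val (f u)) - (\val (f w) - \val (f u)) by ring.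
exact: ZinvB.
Qed.

Lemma pl_Zinv x : Zinv m (\val (f x)) <-> Zinv m (\val x).
Proof.
have [|z z0] := @unit_itv_lift 0; first by rewrite lexx ler01.
have fz : f z = z.
  have [y yz] : exists y, f y = z by exists (homeo_inv_fun f z); exact: homeo_inv_funK.
  suff yE : y = z by rewrite -{1}yE yz.
  apply: val_inj; apply/eqP; rewrite eq_le; apply/andP; split.
    by rewrite -pl_leE yz z0; have := unit_itvP (f z); lra.
  by rewrite z0; have := unit_itvP y; lra.
have [xz|xz] := eqVneq x z; first by rewrite xz fz.
have zx : \val z < \val x.
  rewrite lt_neqAle z0; have /andP[-> _] := unit_itvP x; rewrite andbT -z0.
  by apply: contra_neq xz => /val_inj.
have zZ : Zinv m (\val z) by rewrite z0; exact: Zinv0.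
by rewrite (pl_Zinv_diff zx zZ) fz z0 subr0.
Qed.

End PLTheory.

Lemma is_brown_thompson1 (R : realType) (m : nat) :
  is_brown_thompson m (1%g : homeo (unit_itv R)).
Proof.
exists [::]; split=> // u v _ _; exists 0, 0 => x _.
by rewrite expr0z mul1r addr0.
Qed.

Lemma is_brown_thompsonV (R : realType) (m : nat) (f : homeo (unit_itv R)) :
  is_brown_thompson m f -> is_brown_thompson m f^-1%g.
Proof.
move=> [B [BZ fB]]; have fK : cancel f (f^-1)%g := homeo_funK f.
have fVK : cancel (f^-1)%g f := homeo_inv_funK f.
pose s : seq (unit_itv R) := pmap insub B.
exists [seq \val (f x) | x <- s]; split.
  by move=> b /mapP[x]; rewrite mem_pmap_sub => xB ->; apply/(pl_Zinv BZ fB)/BZ.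
move=> u v uv guv.
have uv' : \val (f^-1%g u) < \val (f^-1%g v) by rewrite -(pl_ltE fB) !fVK.
have [b bB buv|e [c [e0 fE]]] := pl_slope fB uv'.
  have [|w wb] := @unit_itv_lift R b.
    have := unit_itvP (f^-1%g u); have := unit_itvP (f^-1%g v); lra.
  rewrite -wb in bB buv.
  rewrite -(pl_ltE fB _ w) -(pl_ltE fB w) !fVK in buv.
  by apply: (guv (\val (f w))) => //; apply: map_f; rewrite mem_pmap_sub.
exists (- e), (- (m%:R ^ e)^-1 * c) => x xuv.
have := fE (f^-1%g x).
rewrite -(pl_leE fB (f^-1%g u)) -(pl_leE fB (f^-1%g x)) !fVK => /(_ xuv) ->.
move: (lt0r_neq0 e0); rewrite -invr_expz; move: (_ ^ e) => r r0.
by rewrite mulrDr mulKf // mulNr addrK.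
Qed.

Lemma is_brown_thompsonM (R : realType) (m : nat) (f g : homeo (unit_itv R)) :
  is_brown_thompson m f -> is_brown_thompson m g ->
  is_brown_thompson m (f * g)%g.
Proof.
move=> [A [AZ fA]] [B [BZ gB]]; have gK : cancel g (g^-1)%g := homeo_funK g.
have gVK : cancel (g^-1)%g g := homeo_inv_funK g.
pose s : seq (unit_itv R) := pmap insub A.
exists (B ++ [seq \val (g^-1%g x) | x <- s]); split.
  move=> b; rewrite mem_cat => /orP[/BZ//|/mapP[x]].
  by rewrite mem_pmap_sub => xA ->; apply/(pl_Zinv BZ gB); rewrite gVK; exact: AZ.
move=> u v uv guv.
have [b bB|e [c [e0 gE]]] := pl_slope gB uv.
  by apply: guv; rewrite mem_cat bB.
have guv' : \val (g u) < \val (g v) by rewrite (pl_ltE gB).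
have [b bA buv|e' [c' [e'0 fE]]] := pl_slope fA guv'.
  have [|w wb] := @unit_itv_lift R b.
    have := unit_itvP (g u); have := unit_itvP (g v); lra.
  rewrite -wb in bA buv; apply: (guv (\val (g^-1%g w))).
    by rewrite mem_cat; apply/orP; right; apply: map_f; rewrite mem_pmap_sub.
  by rewrite -(pl_ltE gB u) -(pl_ltE gB _ v) gVK.
exists (e' + e), (m%:R ^ e' * c + c') => x xuv.
rewrite -expz_neq0D ?lt0r_neq0 //= fE ?(pl_leE gB) // gE //.
by rewrite mulrDr mulrA addrA.
Qed.

Definition brown_thompson_pred (R : realType) (m : nat)
  : {pred homeo (unit_itv R)} := fun f => `[< is_brown_thompson m f >].
Arguments brown_thompson_pred R m : clear implicits.

Lemma brown_thompson_group_closed (R : realType) (m : nat) :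
  group_closed (brown_thompson_pred R m).
Proof.
split=> [|f g /asboolP fm /asboolP gm]; apply/asboolP.
  exact: is_brown_thompson1.
by apply: is_brown_thompsonM => //; exact: is_brown_thompsonV.
Qed.

(* F_m for m >= 2; degenerates to the trivial group for m = 0, 1. *)
Definition brown_thompson (R : realType) (m : nat) : Type :=
  {f : homeo (unit_itv R) | brown_thompson_pred R m f}.

HB.instance Definition _ (R : realType) (m : nat) :=
  SubChoice.on (brown_thompson R m).
HB.instance Definition _ (R : realType) (m : nat) :=
  SubChoice_isSubGroup.Build (homeo (unit_itv R)) (brown_thompson_pred R m)
    (brown_thompson R m) (@brown_thompson_group_closed R m).

Section Subgroups.
Local Open Scope group_scope.
Context {G : groupType}.
Implicit Types H K : set G.

Definition subgroup H : Prop := group_closed [in H].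

Definition maximal_subgroup H : Prop :=
  [/\ subgroup H, H != [set: G] &
      forall K, subgroup K -> K != [set: G] -> H `<=` K -> K = H].

Definition left_cosets H : set (set G) :=
  [set [set g * h | h in H] | g in [set: G]].

Definition infinite_index H : Prop := infinite_set (left_cosets H).

Definition subgroup_isog H (L : groupType) : Prop :=
  exists phi : {multiplicative L -> G}, set_bij [set: L] H phi.

End Subgroups.

Definition fixes (R : realType) (m : nat) (H : set (brown_thompson R m))
    (x : unit_itv R) : Prop :=
  forall h, H h -> \val h x = x.

(* Main.v *)
Require Import Defs.
From HB Require Import structures.
From mathcomp Require Import all_boot all_order all_algebra.
From mathcomp Require Import all_classical all_reals all_analysis.
From mathcomp Require Import ring lra zify.

(** Put [N = 2n - 1].  The subgroup is a conjugate of [F_N] by a homeomorphism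
    [th] of the unit interval, chosen so that it lands in [F_n].

    Cutting an interval into [n] equal pieces and one of these into [n] again
    gives [N] pieces.  Imitating in this way the subdivision of [[0, 1]] into
    [N], [N^2], ... equal intervals, one gets an order isomorphism between the
    [N]-adic and the [n]-adic numbers of [[0, 1]], which extends to [th]
    ([subdivision_homeo]).  Call the intervals so obtained nodes.  Which piece
    of a node is cut twice is a free choice; if it depends only on the residue
    modulo [n - 1] of the left end of the node and on whether the node touches
    [1], then affine maps between [N]-adic intervals become affine maps between
    nodes, and conjugation by [th] sends [F_N] into [F_n]
    ([brown_thompson_conj]).

    The [n]-adic numbers have a residue modulo [n - 1], which [F_n] preserves.
    Through [th], which relates them to [N]-adic numbers, they also have a
    residue modulo [N - 1 = 2(n - 1)], their colour, which refines the first one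
    and which the conjugate [H] of [F_N] preserves.  An element [g] of [F_n]
    therefore either keeps the colour of a point or adds [n - 1] to it; in the
    second case it flips the point.  The cut is chosen so that the left end of
    the piece cut twice always has residue [n - 2].  As a consequence, which
    points [g] flips is given by a step function with finitely many jumps, all
    of them at points of residue [0], and it vanishes near [0] and near [1]
    ([flip_tame]).  Moreover [H] consists of all the elements that flip nothing
    ([unflipped_conj]).

    Flips satisfy the cocycle rule [flip (f g) x = flip f (g x) + flip g x] in
    Z/2 ([flip_act]), and maximality follows.  Let a subgroup [K] contain [H]
    and some [g] that flips a point, and let [p] be a point where [g] starts to
    flip.  If [h] in [H] moves a point [r] of the same colour to [p] and is
    supported near [p], then [g h g^-1] flips exactly the points between [g r]
    and [g p] ([conj_flips]).  As [H] is transitive on increasing pairs of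
    points with given colours, only the colours of the two ends matter; taking
    [r] on either side of [p], and then repeating this with the elements just
    found, produces all four combinations of colours.  So for all [y1 < y2] of
    residue [0], [K] has an element that flips exactly the points of [[y1, y2)]
    ([flips_on_all]).  Such elements remove the runs of flipped points of any
    [f] in [F_n] one after the other, which leads into [H], so that [K] is all
    of [F_n] ([subgroup_full]).

    The index is infinite because elements flipping different intervals
    have inverses in different left cosets of [H], and [H] has no fixed point in
    the interior because [F_N] has none. *)
Set Implicit Arguments.
Unset Strict Implicit.
Unset Printing Implicit Defensive.

Import Order.TTheory GRing.Theory Num.Theory.
Import numFieldNormedType.Exports.

Local Open Scope classical_set_scope.
Local Open Scope ring_scope.

(** * Homeomorphisms of the unit interval as real functions *)
Section Action.
Context {R : realType}.
Implicit Types (x y : R) (f g : homeo (unit_itv R)).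

Fact clamp_subproof x : Num.min 1 (Num.max 0 x) \in unit_itv R.
Proof.
rewrite inE /unit_itv /= in_itv /= ge_min lexx le_min ler01 le_max lexx.
by [].
Qed.

(** Clamping makes the action of a homeomorphism a total function on [R], so
    that points can be handled as plain reals with a bound as hypothesis. *)
Definition clamp x : unit_itv R :=
  exist (fun z => z \in unit_itv R) _ (clamp_subproof x).

Lemma val_clamp x : 0 <= x <= 1 -> \val (clamp x) = x.
Proof. by move=> /andP[x0 x1]; rewrite /= (max_idPr x0) (min_idPr x1). Qed.

Lemma clamp_val (z : unit_itv R) : clamp (\val z) = z.
Proof. by apply: val_inj; rewrite val_clamp // unit_itvP. Qed.

Definition act f x : R := \val (f (clamp x)).

Lemma act_itv f x : 0 <= act f x <= 1. Proof. exact: unit_itvP. Qed.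

Lemma act_val f (z : unit_itv R) : \val (f z) = act f (\val z).
Proof. by rewrite /act clamp_val. Qed.

Lemma actM f g x : act (f * g)%g x = act f (act g x).
Proof. by rewrite /act clamp_val. Qed.

Lemma act1 x : 0 <= x <= 1 -> act 1%g x = x.
Proof. exact: val_clamp. Qed.

Lemma actK f x : 0 <= x <= 1 -> act f^-1%g (act f x) = x.
Proof. by move=> x01; rewrite -actM mulVg act1. Qed.

Lemma actVK f x : 0 <= x <= 1 -> act f (act f^-1%g x) = x.
Proof. by move=> x01; rewrite -actM mulgV act1. Qed.

Definition increasing f :=
  forall x y, 0 <= x -> x < y -> y <= 1 -> act f x < act f y.

Lemma act_ltE f x y : increasing f -> 0 <= x <= 1 -> 0 <= y <= 1 ->
  (act f x < act f y) = (x < y).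
Proof.
move=> fi /andP[x0 x1] /andP[y0 y1].
case: (ltgtP x y) => [xy|yx|->]; [exact: fi| |exact: ltxx].
by apply/negbTE; rewrite -leNgt ltW // fi.
Qed.

Lemma act_leE f x y : increasing f -> 0 <= x <= 1 -> 0 <= y <= 1 ->
  (act f x <= act f y) = (x <= y).
Proof. by move=> fi xI yI; rewrite !leNgt act_ltE. Qed.

Lemma act_inj f x y : 0 <= x <= 1 -> 0 <= y <= 1 -> act f x = act f y -> x = y.
Proof. by move=> xI yI e; rewrite -(actK f xI) e actK. Qed.

Lemma increasingV f : increasing f -> increasing f^-1%g.
Proof.
move=> fi x y x0 xy y1; have xI : 0 <= x <= 1 by lra.
have yI : 0 <= y <= 1 by lra.
by rewrite -(act_ltE fi) ?act_itv // !actVK.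
Qed.

Lemma increasingM f g : increasing f -> increasing g -> increasing (f * g)%g.
Proof.
move=> fi gi x y x0 xy y1; rewrite !actM !act_ltE ?act_itv //; lra.
Qed.

Lemma act_at0 f : increasing f -> act f 0 = 0.
Proof.
move=> fi; have I0 : 0 <= (0 : R) <= 1 by rewrite lexx ler01.
apply/eqP; rewrite eq_le; have /andP[-> _] := act_itv f 0; rewrite andbT.
by rewrite -[leRHS](actVK f I0) act_leE ?act_itv //; have /andP[] := act_itv f^-1%g 0.
Qed.

Lemma act_at1 f : increasing f -> act f 1 = 1.
Proof.
move=> fi; have I1 : 0 <= (1 : R) <= 1 by rewrite lexx ler01.
apply/eqP; rewrite eq_le; have /andP[_ ->] := act_itv f 1; rewrite /=.
by rewrite -[leLHS](actVK f I1) act_leE ?act_itv //; have /andP[] := act_itv f^-1%g 1.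
Qed.

Lemma unit_itv_continuous (F : unit_itv R -> unit_itv R) :
    (forall u v, \val u < \val v -> \val (F u) < \val (F v)) ->
    (forall v, exists u, F u = v) ->
  continuous F.
Proof.
move=> Finc Fsur.
have Fle u v : (\val (F u) <= \val (F v)) = (\val u <= \val v).
  case: (ltgtP (\val u) (\val v)) => [/Finc/ltW -> //|/Finc|/val_inj ->].
    by rewrite ltNge => /negbTE.
  by rewrite lexx.
pose h x : R := \val (F (clamp x)).
have i0 : 0 <= (0 : R) <= 1 by rewrite lexx ler01.
have i1 : 0 <= (1 : R) <= 1 by rewrite lexx ler01.
have h0 : h 0 = 0.
  have [u uE] := Fsur (clamp 0); apply/eqP; rewrite eq_le.
  have /andP[-> _] := unit_itvP (F (clamp 0)); rewrite andbT.
  rewrite -[leRHS](val_clamp i0) -uE Fle val_clamp //.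
  by have /andP[] := unit_itvP u.
have h1 : h 1 = 1.
  have [u uE] := Fsur (clamp 1); apply/eqP; rewrite eq_le.
  have /andP[_ ->] := unit_itvP (F (clamp 1)); rewrite /=.
  rewrite -[leLHS](val_clamp i1) -uE Fle val_clamp //.
  by have /andP[] := unit_itvP u.
have hc : {within (unit_itv R), continuous h}.
  apply: segment_inc_surj_continuous => [x y|y].
    by rewrite !in_itv /= => xI yI; rewrite /h Fle !val_clamp.
  rewrite h0 h1 /= in_itv /= => yI; have [u uE] := Fsur (clamp y).
  exists (\val u); first by rewrite in_itv /= unit_itvP.
  by rewrite /h clamp_val uE val_clamp.
have {}hc : continuous (sigL (unit_itv R) h) by apply/subspace_sigL_continuousP.
move=> x U [_ [[B oB <-] Bx BU]].
have hx : sigL (unit_itv R) h = \val \o F.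
  by apply/funext => z; rewrite /= /sigL /= /h clamp_val.
have := hc x B; rewrite hx => /(_ _)/= H.
have /H : nbhs (\val (F x)) B by apply: open_nbhs_nbhs.
by rewrite !nbhs_simpl /=; apply: filterS => z; exact: BU.
Qed.

(** For increasing maps continuity comes for free from surjectivity, also that
    of the inverse; so homeomorphisms are built by order considerations only. *)
Lemma homeo_of_increasing (F : R -> R) :
    (forall x, 0 <= x <= 1 -> 0 <= F x <= 1) ->
    (forall x y, 0 <= x -> x < y -> y <= 1 -> F x < F y) ->
    (forall y, 0 <= y <= 1 -> exists2 x, 0 <= x <= 1 & F x = y) ->
  exists f : homeo (unit_itv R), forall x, 0 <= x <= 1 -> act f x = F x.
Proof.
move=> FI Finc Fsur.
pose h (z : unit_itv R) : unit_itv R := clamp (F (\val z)).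
have vh z : \val (h z) = F (\val z) by rewrite val_clamp // FI // unit_itvP.
have hinc u v : \val u < \val v -> \val (h u) < \val (h v).
  move=> uv; rewrite !vh; have := unit_itvP u; have := unit_itvP v.
  by move=> /andP[? ?] /andP[? ?]; exact: Finc.
have hsur v : exists u, h u = v.
  have [x xI xE] := Fsur _ (unit_itvP v); exists (clamp x).
  by apply: val_inj; rewrite vh val_clamp.
have hinj : injective h.
  move=> u v uv; apply: val_inj.
  by case: (ltgtP (\val u) (\val v)) => // /hinc; rewrite uv ltxx.
have [k kE] := choice hsur.
have hK : cancel h k by move=> u; apply: hinj; rewrite kE.
have hh : is_homeo h.
  exists k; split=> //; first exact: unit_itv_continuous.
  apply: unit_itv_continuous => [u v uv|v]; last by exists (h v).
  rewrite ltNge; apply/negP; rewrite le_eqVlt => /orP[/eqP/val_inj vu|/hinc].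
    by move: uv; rewrite -(kE u) -(kE v) vu ltxx.
  by rewrite !kE; apply/negP; rewrite -leNgt ltW.
exists (Homeo hh) => x xI; rewrite /act -[LHS]/(\val (h (clamp x))).
by rewrite vh val_clamp.
Qed.

End Action.

(** * Numbers with denominator a power of the base *)
Lemma nat_crossing (P : nat -> bool) M : P 0%N -> ~~ P M ->
  exists a, [/\ (a < M)%N, P a & ~~ P a.+1].
Proof.
move=> P0; elim: M => [|M IH] PM; first by rewrite P0 in PM.
have [PM'|/IH[a [aM Pa Pa1]]] := boolP (P M); first by exists M.
by exists a; split=> //; exact: ltnW.
Qed.

Section Adic.
Context {R : realType} (m : nat).
Hypothesis m_gt1 : (1 < m)%N.
Implicit Types (x y z a b c d : R) (e : int) (f g : homeo (unit_itv R)).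

Lemma m_neq0 : (m%:R : R) != 0.
Proof. by rewrite pnatr_eq0 -lt0n ltnW. Qed.

Lemma pow_gt0 e : 0 < (m%:R : R) ^ e.
Proof. by rewrite exprz_gt0 // ltr0n ltnW. Qed.

Lemma pow_neq0 e : (m%:R : R) ^ e != 0.
Proof. exact: lt0r_neq0 (pow_gt0 e). Qed.

Lemma powS e : (m%:R : R) ^ (e + 1) = m%:R * m%:R ^ e.
Proof. by rewrite addrC exprzDr ?unitfE ?m_neq0 // expr1z. Qed.

Lemma powN e : (m%:R : R) ^ (- e) = (m%:R ^ e)^-1.
Proof. by rewrite -invr_expz. Qed.

Lemma ZinvM x y : Zinv m x -> Zinv m y -> Zinv m (x * y).
Proof.
move=> [a [k ->]] [b [l ->]]; exists (a * b), (k + l)%N.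
have mk : m%:R ^+ k != 0 :> R by rewrite expf_neq0 // m_neq0.
have ml : m%:R ^+ l != 0 :> R by rewrite expf_neq0 // m_neq0.
by rewrite rmorphM /= exprD; field; rewrite mk ml.
Qed.

Lemma Zinv_pow e : Zinv m ((m%:R : R) ^ e).
Proof.
rewrite -[_ ^ e]mulr1; apply: Zinv_scale; first exact: pow_neq0.
by exists 1, 0%N; rewrite divr1.
Qed.

Lemma Zinv_nat k : Zinv m (k%:R : R).
Proof. by exists k%:Z, 0%N; rewrite divr1. Qed.

Lemma Zinv_one : Zinv m (1 : R). Proof. exact: (Zinv_nat 1). Qed.

(** Congruence modulo the ideal of Z[1/m] generated by [m - 1].  As [m] is 1 in
    the quotient, scaling by a power of [m] does not change the class. *)
Definition Zcong x y := exists2 z, Zinv m z & x - y = (m%:R - 1) * z.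

Lemma Zcong_refl x : Zcong x x.
Proof. by exists 0; [exact: Zinv0|rewrite subrr mulr0]. Qed.

Lemma Zcong_sym x y : Zcong x y -> Zcong y x.
Proof.
move=> [z zZ e]; exists (0 - z); first by apply: ZinvB => //; exact: Zinv0.
by rewrite -opprB e; ring.
Qed.

Lemma Zcong_trans y x z : Zcong x y -> Zcong y z -> Zcong x z.
Proof.
move=> [u uZ eu] [v vZ ev]; exists (u + v); first exact: ZinvD.
have -> : x - z = (x - y) + (y - z) by ring.
by rewrite eu ev mulrDr.
Qed.

Lemma Zcong_add x y x' y' : Zcong x y -> Zcong x' y' -> Zcong (x + x') (y + y').
Proof.
move=> [u uZ eu] [v vZ ev]; exists (u + v); first exact: ZinvD.
by rewrite mulrDr -eu -ev; ring.
Qed.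

Lemma Zcong_scale e x : Zinv m x -> Zcong (m%:R ^ e * x) x.
Proof.
suff [z zZ zE] : exists2 z : R, Zinv m z & m%:R ^ e - 1 = (m%:R - 1) * z.
  by move=> xZ; exists (z * x); [exact: ZinvM|rewrite mulrA -zE; ring].
have natpow k : exists2 z : R, Zinv m z & m%:R ^+ k - 1 = (m%:R - 1) * z.
  elim: k => [|k [z zZ zE]]; first by exists 0; [exact: Zinv0|rewrite expr0; ring].
  exists (m%:R ^ (k : int) + z); first by apply: ZinvD => //; exact: Zinv_pow.
  by rewrite mulrDr -zE exprS -exprnP; ring.
case: e => [k|k]; first exact: natpow.
have [z zZ zE] := natpow k.+1; exists (- (m%:R ^ Negz k * z)).
  rewrite -[- _]add0r; apply: ZinvB; first exact: Zinv0.
  by apply: ZinvM => //; exact: Zinv_pow.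
rewrite mulrN mulrCA -zE NegzE powN -exprnP.
by have /= := pow_neq0 k.+1; rewrite -exprnP => ?; field.
Qed.

Lemma Zinv_cong x y : Zcong x y -> Zinv m y -> Zinv m x.
Proof.
move=> [z zZ e] yZ; rewrite -(subrK y x) e; apply: ZinvD => //.
apply: ZinvM => //; apply: ZinvB; [exact: Zinv_nat|exact: Zinv_one].
Qed.

Lemma exists_pow x : 0 < x -> exists e : int, m%:R ^ e <= x < m%:R ^ (e + 1).
Proof.
move=> x0.
have big (y : R) : exists k : nat, y < m%:R ^+ k.
  exists (Num.bound `|y|); apply: (le_lt_trans (ler_norm y)).
  apply: lt_trans (archi_boundP (normr_ge0 y)) _.
  by rewrite -natrX ltr_nat ltn_expl.
have [k xk] := big x; have [l xl] := big x^-1.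
(* [nat_crossing] works on naturals, so exponents are counted from [- l]. *)
pose P i := m%:R ^ ((i : int) - (l : int)) <= x.
have [||i [_ Pi]] := @nat_crossing P (l + k)%N.
- rewrite /P sub0r powN -exprnP invf_ple ?posrE ?exprn_gt0 ?ltr0n 1?ltnW //.
  exact: ltW.
- by rewrite /P PoszD addrAC subrr add0r -exprnP -ltNge.
rewrite -ltNge => iP; exists ((i : int) - (l : int)); apply/andP; split=> //.
by move: iP; rewrite -addn1 PoszD addrAC.
Qed.

End Adic.

(** * Piecewise linear bijections *)
Section PLBijections.
Context {R : realType} (m : nat).
Hypothesis m_gt1 : (1 < m)%N.
Implicit Types (x y z a b c d : R) (e : int) (f g : homeo (unit_itv R)).
Notation Zcong := (@Zcong R m).

Definition affine_on (F : R -> R) a b := exists e, exists c,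
  forall x, a <= x <= b -> F x = m%:R ^ e * x + c.

Lemma affine_onS F a b a' b' :
  affine_on F a b -> a <= a' -> b' <= b -> affine_on F a' b'.
Proof. by move=> [e [c E]] aa bb; exists e, c => x xI; apply: E; lra. Qed.

Definition affine_off (B : seq R) (F : R -> R) a b := forall u v,
  a <= u -> u < v -> v <= b -> (forall z, z \in B -> ~ (u < z < v)) ->
  affine_on F u v.

Lemma brown_thompsonP f : is_brown_thompson m f <->
  exists2 B, (forall b, b \in B -> Zinv m b) & affine_off B (act f) 0 1.
Proof.
split=> [[B [BZ fB]]|[B BZ fB]]; exists B => //.
  move=> u v u0 uv v1 guv.
  have uI : 0 <= u <= 1 by lra.
  have vI : 0 <= v <= 1 by lra.
  have [||e [c E]] := fB (clamp u) (clamp v).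
  - by rewrite !val_clamp.
  - by move=> b bB; rewrite !val_clamp //; exact: guv.
  exists e, c => x xI; have xI1 : 0 <= x <= 1 by lra.
  by rewrite /act E !val_clamp.
split=> // u v uv guv; have /andP[? ?] := unit_itvP u.
have /andP[? ?] := unit_itvP v.
have [||e [c E]] := fB (\val u) (\val v) _ uv _ guv; try by [].
by exists e, c => x xI; rewrite act_val E.
Qed.

Lemma brown_thompson_increasing f : is_brown_thompson m f -> increasing f.
Proof.
move=> [B [_ fB]] x y x0 xy y1; apply: (pl_lt fB).
by rewrite !val_clamp //; lra.
Qed.

(** The form in which membership is checked later on: the pieces that come from
    a subdivision are listed from left to right. *)
Lemma brown_thompson_of_pieces f (p : nat -> R) M : p 0%N = 0 -> p M = 1 ->
    (forall i, (i <= M)%N -> Zinv m (p i)) ->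
    (forall i, (i < M)%N -> affine_on (act f) (p i) (p i.+1)) ->
  is_brown_thompson m f.
Proof.
move=> p0 pM pZ pA; apply/brown_thompsonP.
exists [seq p i | i <- iota 0 M.+1].
  by move=> b /mapP[i]; rewrite mem_iota => iM ->; exact: pZ.
move=> u v u0 uv v1 guv.
have [||i [iM pi pi1]] := @nat_crossing (fun i => p i <= u) M.
- by rewrite p0.
- by rewrite pM -ltNge; lra.
apply: affine_onS (pA _ iM) pi _.
rewrite leNgt; apply/negP => pv.
apply: (guv (p i.+1)); last by rewrite ltNge pi1.
by apply/mapP; exists i.+1; rewrite // mem_iota.
Qed.

(** The break points are kept as a list that every gap has to avoid, as in
    the definition of [is_brown_thompson]: such lists are merely concatenated
    when two maps are glued. *)
Definition pl_bij (F : R -> R) a b c d : Prop :=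
  [/\ F a = c, F b = d,
      (forall x y, a <= x -> x < y -> y <= b -> F x < F y),
      (forall y, c <= y <= d -> exists2 x, a <= x <= b & F x = y) &
      exists2 B, (forall z, z \in B -> Zinv m z) & affine_off B F a b].

Lemma pl_bij_affine a b e c : a <= b -> Zinv m a -> Zinv m b ->
  pl_bij (fun x => c + m%:R ^ e * (x - a)) a b c (c + m%:R ^ e * (b - a)).
Proof.
move=> ab aZ bZ; have e0 := @pow_gt0 R m m_gt1 e; split=> //.
- by rewrite subrr mulr0 addr0.
- by move=> x y _ xy _; rewrite ltrD2l ltr_pM2l // ltrD2r.
- move=> y /andP[cy yd]; exists (a + (m%:R ^ e)^-1 * (y - c)); last first.
    by have := lt0r_neq0 e0 => ?; field.
  rewrite lerDl mulr_ge0 ?invr_ge0 ?(ltW e0) ?subr_ge0 //=.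
  by rewrite -lerBrDl ler_pdivrMl // lerBlDl.
- exists [::] => // u v _ _ _ _; exists e, (c - m%:R ^ e * a) => x _; ring.
Qed.

Lemma pl_bij_glue F G a b c d a' d' : a <= b -> b <= c -> Zinv m b ->
  pl_bij F a b a' d -> pl_bij G b c d d' ->
  pl_bij (fun x => if x <= b then F x else G x) a c a' d'.
Proof.
move=> ab bc bZ [Fa Fb Fi Fs [B1 BZ1 FB]] [Gb Gc Gi Gs [B2 BZ2 GB]].
have FG x : b <= x -> (if x <= b then F x else G x) = G x.
  by move=> bx; case: ifP => // xb; rewrite (_ : x = b) ?Fb ?Gb //; lra.
split.
- by rewrite ab.
- by rewrite FG.
- move=> x y ax xy yc; case: (leP y b) => yb.
    by rewrite (le_trans (ltW xy) yb); exact: Fi.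
  case: ifPn => xb; last by rewrite -ltNge in xb; apply: Gi => //; exact: ltW.
  have : F x <= d.
    by rewrite -Fb; move: xb; rewrite le_eqVlt => /predU1P[->|xb] //; exact/ltW/Fi.
  by move=> /le_lt_trans; apply; rewrite -Gb; apply: Gi.
- move=> y /andP[ay yd]; case: (leP y d) => ydd.
    have [|x /andP[ax xb] xE] := Fs y; first by rewrite ay.
    by exists x; [lra|rewrite xb].
  have [|x /andP[bx xc] xE] := Gs y; first by rewrite ltW.
  by exists x; [lra|rewrite FG].
- exists (b :: B1 ++ B2).
    by move=> z; rewrite inE mem_cat => /predU1P[->//|/orP[/BZ1|/BZ2]].
  move=> u v au uv vc guv; case: (leP v b) => vb.
    have [|e [k E]] := FB u v au uv vb.
      by move=> z zB; apply: guv; rewrite inE mem_cat zB orbT.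
    exists e, k => x /andP[ux xv].
    by rewrite (le_trans xv vb) E // ux.
  have bu : b <= u.
    rewrite leNgt; apply/negP => ub; apply: (guv b); first by rewrite mem_head.
    by rewrite ub.
  have [|e [k E]] := GB u v bu uv vc.
    by move=> z zB; apply: guv; rewrite inE mem_cat zB !orbT.
  exists e, k => x /andP[ux xv].
  by rewrite FG ?(le_trans bu ux) // E // ux.
Qed.

(** Two slopes suffice.  For the lengths [L] and [L'] take [e] with
    [m^e L <= L' < m^(e+1) L] and use slope [m^(e+1)], then slope [m^e].  The
    length of the first piece is [(L' / m^e - L) / (m - 1)], which the congruence
    makes [m]-adic. *)
Lemma pl_bij_exists a b c d : a < b -> c < d -> Zinv m a -> Zinv m b ->
  Zcong (d - c) (b - a) -> exists F, pl_bij F a b c d.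
Proof.
move=> ab cd aZ bZ dcba.
have L0 : 0 < b - a by lra.
have L'0 : 0 < d - c by lra.
have [e /andP[e1 e2]] := exists_pow m_gt1 (divr_gt0 L'0 L0).
rewrite ler_pdivlMr // in e1; rewrite ltr_pdivrMr // powS // in e2.
have e0 := @pow_gt0 R m m_gt1 e.
have m1 : 0 < (m%:R : R) - 1 by rewrite subr_gt0 ltr1n.
have ne := lt0r_neq0 e0; have nm := lt0r_neq0 m1.
have [z zZ zE] : Zcong (m%:R ^ (- e) * (d - c)) (b - a).
  apply: (Zcong_trans _ dcba); apply: Zcong_scale => //.
  by apply: (Zinv_cong m_gt1 dcba); exact: ZinvB.
rewrite powN // in zE.
have LE : d - c = m%:R ^ e * (b - a + (m%:R - 1) * z).
  by rewrite -zE; field.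
have z0 : 0 <= z.
  by rewrite LE ler_pM2l // lerDl pmulr_rge0 // in e1.
have zL : z < b - a.
  rewrite LE mulrAC [ltRHS]mulrC ltr_pM2l // in e2.
  by rewrite -(ltr_pM2l m1); lra.
have azZ : Zinv m (a + z) by exact: ZinvD.
have az : a <= a + z by lra.
have zb : a + z <= b by lra.
have H1 := @pl_bij_affine a (a + z) (e + 1) c az aZ azZ.
have H2 := @pl_bij_affine (a + z) b e (c + m%:R ^ (e + 1) * (a + z - a))
  zb azZ bZ.
have := pl_bij_glue az zb azZ H1 H2.
have -> : c + m%:R ^ (e + 1) * (a + z - a) + m%:R ^ e * (b - (a + z)) = d.
  by rewrite powS // -[RHS](subrK c) LE; ring.
by move=> H; eexists; exact: H.
Qed.

Lemma brown_thompson_of_pl_bij F : pl_bij F 0 1 0 1 ->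
  exists2 f : homeo (unit_itv R), is_brown_thompson m f &
    forall x, 0 <= x <= 1 -> act f x = F x.
Proof.
move=> [F0 F1 Fi Fs [B BZ FB]].
have [x /andP[x0 x1]|//|//|f fE] := @homeo_of_increasing R F.
  apply/andP; split.
    have [<-|x0'] := eqVneq 0 x; first by rewrite F0.
    by rewrite -{1}F0 ltW // Fi // lt_neqAle x0'.
  have [->|x1'] := eqVneq x 1; first by rewrite F1.
  by rewrite -F1 ltW // Fi // lt_neqAle x1'.
exists f => //; apply/brown_thompsonP; exists B => // u v u0 uv v1 guv.
have [e [c E]] := FB u v u0 uv v1 guv.
by exists e, c => x xI; rewrite fE ?E //; lra.
Qed.

Lemma pl_bij_id a b : a <= b -> Zinv m a -> Zinv m b ->
  exists2 F, pl_bij F a b a b & forall x, F x = x.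
Proof.
move=> ab aZ bZ; have := @pl_bij_affine a b 0 a ab aZ bZ.
have -> : a + m%:R ^ 0 * (b - a) = b by rewrite expr0z; ring.
by move=> H; eexists; [exact: H|move=> x /=; rewrite expr0z; ring].
Qed.

(** Elements of [F_m] supported in a small interval are as transitive as
    residues allow. *)
Lemma move_point c d x y : 0 <= c -> d <= 1 -> c < x < d -> c < y < d ->
    Zinv m c -> Zinv m d -> Zinv m x -> Zcong y x ->
  exists f, [/\ is_brown_thompson m f, act f x = y &
    forall t, 0 <= t <= 1 -> t <= c \/ d <= t -> act f t = t].
Proof.
move=> c0 d1 /andP[cx xd] /andP[cy yd] cZ dZ xZ xy.
have [F1 H1 E1] := pl_bij_id c0 (Zinv0 m) cZ.
have [F4 H4 E4] := pl_bij_id d1 dZ (Zinv_one m).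
have cr : Zcong (- c) (- c) := Zcong_refl m _.
have [|F2 H2] := pl_bij_exists cx cy cZ xZ; first exact: Zcong_add.
have [|F3 H3] := pl_bij_exists xd yd xZ dZ.
  apply: Zcong_add; first exact: Zcong_refl.
  have [z zZ zE] := Zcong_sym xy; exists z => //; rewrite -zE; ring.
have H23 := pl_bij_glue (ltW cx) (ltW xd) xZ H2 H3.
have H123 := pl_bij_glue c0 (ltW (lt_trans cx xd)) cZ H1 H23.
have /= H := pl_bij_glue (le_trans c0 (ltW (lt_trans cx xd))) d1 dZ H123 H4.
have [f fB fE] := brown_thompson_of_pl_bij H.
exists f; split=> //.
  rewrite fE; last lra.
  by rewrite (ltW xd) leNgt cx /= lexx; have [] := H2.
move=> t tI; rewrite fE // => -[tc|dt].
  by rewrite tc (le_trans tc) ?E1 // ltW // (lt_trans cx).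
case: (leP t d) => td; last by rewrite E4.
have -> : t = d by lra.
rewrite leNgt (lt_trans cx xd) /= leNgt xd /=.
by have [] := H3.
Qed.

(** On each affine piece lengths are multiplied by a power of [m], which is 1
    modulo [m - 1]; summing over the pieces between [0] and [x] gives this. *)
Lemma brown_thompson_cong f x : is_brown_thompson m f -> 0 <= x <= 1 ->
  Zinv m x -> Zcong (act f x) x.
Proof.
move=> fB xI xZ; have fi := brown_thompson_increasing fB.
have [x0|x0] := eqVneq x 0; first by rewrite x0 act_at0 //; exact: Zcong_refl.
case: (fB) => B [BZ fP].
have step (u v : unit_itv R) : \val u < \val v -> Zinv m (\val u) ->
    Zinv m (\val v) ->
    Zcong (\val (f v) - \val (f u)) (\val v - \val u).
  move: u v; apply: (gap_ind (B := B)).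
    move=> u v uv guv uZ vZ; have [e [c [e0 E]]] := pl_slope fP uv guv.
    rewrite !E ?lexx ?ltW //.
    have -> : m%:R ^ e * \val v + c - (m%:R ^ e * \val u + c) =
      m%:R ^ e * (\val v - \val u) by ring.
    by apply: Zcong_scale => //; exact: ZinvB.
  move=> u w v uw wv /BZ wZ IH1 IH2 uZ vZ.
  have := Zcong_add (IH1 uZ wZ) (IH2 wZ vZ).
  by congr Zcong; ring.
have I0 : 0 <= (0 : R) <= 1 by rewrite lexx ler01.
have := step (clamp 0) (clamp x).
rewrite !val_clamp // !act_val !val_clamp // act_at0 // !subr0; apply=> //.
  by rewrite lt_neqAle eq_sym x0; case/andP: xI.
exact: Zinv0.
Qed.

Lemma brown_thompson_Zinv f x : is_brown_thompson m f -> 0 <= x <= 1 ->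
  Zinv m x -> Zinv m (act f x).
Proof.
by move=> fB xI xZ; apply: (Zinv_cong m_gt1 (brown_thompson_cong fB xI xZ)).
Qed.

End PLBijections.

Lemma eventually_bounded (A : nat) (P : nat -> nat -> Prop) :
    (forall a, (a < A)%N -> exists M, forall k, (M <= k)%N -> P a k) ->
  exists M, forall k, (M <= k)%N -> forall a, (a < A)%N -> P a k.
Proof.
elim: A => [|A IH] H; first by exists 0%N.
have [a aA|M HM] := IH; first by apply: H; exact: ltnW.
have [M' HM'] := H A (ltnSn A); exists (maxn M M') => k; rewrite geq_max.
move=> /andP[Mk M'k] a; rewrite ltnS leq_eqVlt => /predU1P[->|aA].
  exact: HM'.
exact: HM.
Qed.

(** * Cells of the grid of mesh a power of the base *)
Section Grid.
Context {R : realType} (m : nat).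
Hypothesis m_gt1 : (1 < m)%N.
Implicit Types (x y z t : R) (e : int) (f g : homeo (unit_itv R)).

Definition adic k a : R := a%:R / m%:R ^+ k.

Lemma expm_gt0 k : 0 < (m%:R : R) ^+ k.
Proof. by rewrite exprn_gt0 // ltr0n ltnW. Qed.

Lemma expm_neq0 k : (m%:R : R) ^+ k != 0.
Proof. exact: lt0r_neq0 (expm_gt0 k). Qed.

Lemma adic0 k : adic k 0 = 0. Proof. by rewrite /adic mul0r. Qed.

Lemma adic1 k : adic k (m ^ k) = 1.
Proof. by rewrite /adic natrX divff // expm_neq0. Qed.

Lemma adic_le k a b : (adic k a <= adic k b) = (a <= b)%N.
Proof. by rewrite /adic ler_pM2r ?invr_gt0 ?expm_gt0 // ler_nat. Qed.

Lemma adic_lt k a b : (adic k a < adic k b) = (a < b)%N.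
Proof. by rewrite !ltNge adic_le ltnNge. Qed.

Lemma adic_itv k a : (a <= m ^ k)%N -> 0 <= adic k a <= 1.
Proof. by move=> ak; rewrite -(adic0 k) -(adic1 k) !adic_le. Qed.

Lemma adic_add k a b : adic k (a + b) = adic k a + adic k b.
Proof. by rewrite /adic natrD mulrDl. Qed.

Lemma adic_refine k j a : adic (k + j) (a * m ^ j) = adic k a.
Proof.
rewrite /adic natrM natrX exprD; have := expm_neq0 k; have := expm_neq0 j.
by move=> ? ?; field; apply/andP.
Qed.

Lemma adic_nested k j a b : adic (k + j) (a * m ^ j + b) = adic k a + adic j b / m%:R ^+ k.
Proof.
rewrite adic_add adic_refine; congr (_ + _).
rewrite /adic exprD; have := expm_neq0 k; have := expm_neq0 j.
by move=> ? ?; field; apply/andP.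
Qed.

Lemma adicS k a : adic k a.+1 = adic k a + (m%:R ^+ k)^-1.
Proof. by rewrite -addn1 adic_add /adic mul1r. Qed.

Lemma Zinv_adic k a : Zinv m (adic k a).
Proof. by exists a%:Z, k. Qed.

Lemma adicP x : 0 <= x <= 1 -> Zinv m x ->
  exists k a, (a <= m ^ k)%N /\ x = adic k a.
Proof.
move=> /andP[x0 x1] [[a|a] [k xE]]; last first.
  move: x0; rewrite xE NegzE mulrNz mulNr oppr_ge0 leNgt => /negP[].
  by rewrite divr_gt0 ?expm_gt0 // ltr0n.
exists k, a; split=> //.
by move: x1; rewrite xE -[a%:~R / _]/(adic k a) -(adic1 k) adic_le.
Qed.

Lemma Zcong_nat_adic k a : Zcong m (adic k a) (a%:R : R).
Proof.
rewrite /adic mulrC.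
have -> : ((m%:R : R) ^+ k)^-1 = m%:R ^ (- k%:Z) by rewrite powN.
by apply: Zcong_scale => //; exact: Zinv_nat.
Qed.

Lemma exp_mod1 k : m ^ k = 1 %[mod m.-1].
Proof.
elim: k => // k IH; rewrite expnS -modnMmr IH modnMmr muln1.
by rewrite -{1}(ltn_predK m_gt1) -addn1 modnDl.
Qed.

Lemma Zcong_natP a b : Zcong m (a%:R : R) b%:R <-> a = b %[mod m.-1].
Proof.
have m1E : (m.-1%:R : R) = m%:R - 1.
  by rewrite -{2}(ltn_predK m_gt1) -addn1 natrD addrK.
split.
  wlog ab : a b / (b <= a)%N => [wl|].
    have [/wl//|/ltnW/wl H /Zcong_sym/H] := leqP b a; last by move=> ->.
  move=> [z [c [k ->]]]; rewrite -natrB // -m1E => E.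
  have {E} : (((a - b) * m ^ k)%N%:Z)%:~R = (m.-1%:Z * c)%:~R :> R.
    rewrite rmorphM /= -!pmulrn natrM natrX E; have := expm_neq0 k => ?.
    by field.
  move=> /intr_inj E; apply/eqP; rewrite eqn_mod_dvd //.
  have : (m.-1%:Z %| ((a - b) * m ^ k)%N%:Z)%Z by rewrite E dvdz_mulr.
  rewrite dvdzE Gauss_dvdl // coprime_sym.
  by rewrite coprimeXl // -{1}(ltn_predK m_gt1) coprimeSn.
move=> /eqP ab; wlog {ab} [c ->] : a b ab / exists c, (a = b + c * m.-1)%N.
  move=> wl; have [ba|/ltnW ba] := leqP b a.
    apply: wl => //; move: ab; rewrite eqn_mod_dvd // => /dvdnP[c cE].
    by exists c; rewrite -cE subnKC.
  rewrite eq_sym in ab.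
  apply/Zcong_sym/wl => //; move: ab; rewrite eqn_mod_dvd // => /dvdnP[c cE].
  by exists c; rewrite -cE subnKC.
exists c%:R; first exact: Zinv_nat.
by rewrite natrD natrM m1E; ring.
Qed.

(** Reading the residue on any fraction that represents [x] turns the congruence
    of [m]-adic points into an equality of natural numbers. *)
Definition residue x : nat :=
  ((xget (0, 0)%N [set ka : nat * nat | x = adic ka.1 ka.2]).2 %% m.-1)%N.

Lemma residue_adic k a : residue (adic k a) = (a %% m.-1)%N.
Proof.
rewrite /residue; case: xgetP => [[l b] _ /= E|/(_ (k, a))] //=.
apply/esym/Zcong_natP.
apply: Zcong_trans (Zcong_nat_adic l b).
by rewrite -E; apply/Zcong_sym/Zcong_nat_adic.
Qed.

Lemma residueP x y : 0 <= x <= 1 -> 0 <= y <= 1 -> Zinv m x -> Zinv m y ->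
  residue x = residue y <-> Zcong m x y.
Proof.
move=> xI yI /(adicP xI)[k [a [_ ->]]] /(adicP yI)[l [b [_ ->]]].
rewrite !residue_adic; split=> [/Zcong_natP H|H].
  apply: Zcong_trans (Zcong_nat_adic k a) _; apply: Zcong_trans H _.
  exact/Zcong_sym/Zcong_nat_adic.
apply/Zcong_natP; apply: Zcong_trans (Zcong_nat_adic l b).
by apply: Zcong_trans H; exact/Zcong_sym/Zcong_nat_adic.
Qed.

Lemma brown_thompson_residue f x : is_brown_thompson m f -> 0 <= x <= 1 ->
  Zinv m x -> residue (act f x) = residue x.
Proof.
move=> fB xI xZ; apply/residueP=> //; first exact: act_itv.
  exact: brown_thompson_Zinv.
exact: brown_thompson_cong.
Qed.

(** [f] maps the cell [[a/m^k, (a+1)/m^k]] affinely onto the cell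
    [[b/m^l, (b+1)/m^l]]. *)
Definition grid_map f k a l b := forall t, 0 <= t <= 1 ->
  act f (adic k a + t / m%:R ^+ k) = adic l b + t / m%:R ^+ l.

Lemma adic_common (B : seq R) : (forall b, b \in B -> Zinv m b) ->
  exists k, forall b, b \in B -> exists c : int, b = c%:~R / m%:R ^+ k.
Proof.
elim: B => [|b B IH] BZ; first by exists 0%N.
have [|k kE] := IH; first by move=> b' b'B; apply: BZ; rewrite inE b'B orbT.
have [c [l bE]] := BZ b (mem_head _ _); exists (k + l)%N => b'.
have := expm_neq0 k; have := expm_neq0 l => mk ml.
rewrite inE => /predU1P[->|/kE[c' ->]].
  exists (c * m%:Z ^+ k); rewrite bE rmorphM rmorphXn /= -pmulrn exprD.
  by field; apply/andP.
exists (c' * m%:Z ^+ l); rewrite rmorphM rmorphXn /= -pmulrn exprD.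
by field; apply/andP.
Qed.

(** On an affine piece of slope [m^e] the image of a cell of mesh [m^-k] has
    length [m^(e-k)], and it is a cell once [k] is so large that the value of [f]
    at the left end of the piece is a multiple of [m^(e-k)].  Finitely many
    pieces give finitely many such conditions on [k]. *)
Lemma brown_thompson_grid f : is_brown_thompson m f -> exists k, forall a,
  (a < m ^ k)%N -> exists l b, (b < m ^ l)%N /\ grid_map f k a l b.
Proof.
move=> fB; have fi := brown_thompson_increasing fB.
have /brown_thompsonP[B BZ fA] := fB.
have [k0 Bk0] := adic_common BZ.
have fA0 a : (a < m ^ k0)%N -> affine_on m (act f) (adic k0 a) (adic k0 a.+1).
  move=> ak; have /andP[? ?] := adic_itv (ltnW ak).
  have /andP[? ?] := adic_itv ak.
  apply: fA => //; first by rewrite adic_lt.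
  move=> z /Bk0[c ->] /andP[]; rewrite /adic !ltr_pM2r ?invr_gt0 ?expm_gt0 //.
  by rewrite !pmulrn !ltr_int; lia.
pose P a k := forall r, (a * m ^ (k - k0) + r < (a.+1) * m ^ (k - k0))%N ->
  exists l b, (b < m ^ l)%N /\ grid_map f k (a * m ^ (k - k0) + r) l b.
have [a ak|M HM] := @eventually_bounded (m ^ k0) P; last first.
  exists (k0 + M)%N => a ak; have mk : (0 < m ^ M)%N by rewrite expn_gt0 ltnW.
  have := HM (k0 + M)%N (leq_addl _ _) (a %/ m ^ M)%N; rewrite /P addKn.
  rewrite ltn_divLR // -expnD => /(_ ak (a %% m ^ M)%N); rewrite -divn_eq.
  by apply; rewrite mulSn addnC -ltn_subLR ?leq_divM // {1}(divn_eq a (m ^ M)) addKn ltn_mod.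
have [e [c E]] := fA0 a ak.
have aI := adic_itv (ltnW ak).
have [L [b0 [b0L y0E]]] := adicP (act_itv f _)
  (brown_thompson_Zinv m_gt1 fB aI (Zinv_adic k0 a)).
exists (k0 + `|e| + L)%N => k kM r rE.
(* The mesh of the cells in the image; [k >= |e|] makes it at most 1. *)
have [l lE] : exists l : nat, l%:Z = k%:Z - e by exists `|k%:Z - e|%N; lia.
have Ll : (L <= l)%N by lia.
have [j jE] : exists j, (k = k0 + j)%N by exists (k - k0)%N; lia.
have [i iE] : exists i, (l = L + i)%N by exists (l - L)%N; lia.
have kj : (k - k0 = j)%N by lia.
rewrite kj in rE *; subst k; clear kj.
have eE : m%:R ^ e / (m%:R : R) ^+ (k0 + j) = (m%:R ^+ l)^-1.
  have -> : e = (k0 + j)%:Z - l%:Z by lia.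
  rewrite exprzDr ?unitfE ?m_neq0 // powN // -!exprnP.
  by have := expm_neq0 (k0 + j); have := expm_neq0 l => ? ?; field; apply/andP.
have rj : (r < m ^ j)%N by move: rE; rewrite mulSn addnC ltn_add2r.
have gE : grid_map f (k0 + j) (a * m ^ j + r) l (b0 * m ^ i + r).
  move=> t /andP[t0 t1].
  have -> : adic (k0 + j) (a * m ^ j + r) + t / m%:R ^+ (k0 + j) =
            adic k0 a + (r%:R + t) / m%:R ^+ (k0 + j).
    by rewrite adic_add adic_refine /adic; ring.
  have rt0 : 0 <= r%:R + t by rewrite addr_ge0.
  have rt1 : (r%:R + t) / m%:R ^+ (k0 + j) <= (m%:R ^+ k0)^-1.
    rewrite exprD invfM mulrCA; apply: ler_piMr.
      by rewrite invr_ge0 ltW // expm_gt0.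
    rewrite ler_pdivrMr ?expm_gt0 // mul1r -natrX.
    by apply: (le_trans (y := r.+1%:R)); [rewrite -natr1 lerD2l|rewrite ler_nat].
  rewrite E; last first.
    by rewrite adicS lerD2l rt1 lerDl divr_ge0 // ltW // expm_gt0.
  rewrite mulrDr addrAC -E; last by rewrite lexx adicS lerDl invr_ge0 ltW ?expm_gt0.
  rewrite y0E mulrCA eE iE adic_add adic_refine -addrA; congr (_ + _).
  by rewrite -iE /adic; ring.
exists l, (b0 * m ^ i + r)%N; split=> //.
have := gE 1 ltac:(by rewrite ler01 lexx); rewrite mul1r -adicS.
rewrite mul1r -adicS => H.
have := act_itv f (adic (k0 + j) (a * m ^ j + r).+1).
by rewrite H => /andP[_]; rewrite -(adic1 l) adic_le.
Qed.

End Grid.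
Arguments adic {R} m k a.

(** * Extending an order isomorphism between dense sets *)
Section DenseExtension.
Context {R : realType}.
Implicit Types (x y u v : R).

(** Graphs are used rather than functions so that the two directions of the
    order isomorphism are treated by the same lemmas. *)
Definition monotone_graph (G : R -> R -> Prop) : Prop :=
  [/\ G 0 0, G 1 1,
      (forall x y, G x y -> 0 <= x <= 1 /\ 0 <= y <= 1),
      (forall x y x' y', G x y -> G x' y' -> (x < x') = (y < y')) &
      (forall u v, 0 <= u -> u < v -> v <= 1 ->
         exists x y, G x y /\ u < x < v)].

Definition graph_sup (G : R -> R -> Prop) x : R :=
  sup [set y | exists2 x', G x' y & x' <= x].

Section OneSided.
Variable G : R -> R -> Prop.
Hypothesis GM : monotone_graph G.

Lemma graph_has_sup x : 0 <= x ->
  has_sup [set y | exists2 x', G x' y & x' <= x].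
Proof.
case: GM => G0 _ GI _ _ x0; split; first by exists 0, 0.
by exists 1 => y /= [x' /GI[_ /andP[]]].
Qed.

Lemma graph_sup_ub x x' y : G x' y -> x' <= x -> y <= graph_sup G x.
Proof.
move=> xy xx; case: GM => _ _ GI _ _; have [/andP[x0 _] _] := GI _ _ xy.
apply: ub_le_sup; last by exists x'.
by have [] := graph_has_sup (le_trans x0 xx).
Qed.

Lemma graph_sup_le x z : 0 <= x -> (forall x' y, G x' y -> x' <= x -> y <= z) ->
  graph_sup G x <= z.
Proof.
move=> x0 H; apply: ge_sup; first by have [] := graph_has_sup x0.
by move=> y /= [x']; exact: H.
Qed.

Lemma graph_supE x y : G x y -> graph_sup G x = y.
Proof.
move=> xy; case: GM => _ _ GI Gm _; have [/andP[x0 _] _] := GI _ _ xy.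
apply/le_anti/andP; split; last exact: graph_sup_ub xy _.
apply: graph_sup_le => // x' y' xy'; rewrite !leNgt; apply: contra.
by rewrite (Gm _ _ _ _ xy xy').
Qed.

Lemma graph_sup_itv x : 0 <= x <= 1 -> 0 <= graph_sup G x <= 1.
Proof.
case: GM => G0 _ GI _ _ /andP[x0 _]; rewrite (graph_sup_ub G0 x0) /=.
by apply: graph_sup_le => // x' y /GI[_ /andP[]].
Qed.

Lemma graph_sup_lt x x' : 0 <= x -> x < x' -> x' <= 1 ->
  graph_sup G x < graph_sup G x'.
Proof.
case: GM => _ _ GI Gm Gd x0 xx' x'1.
(* Two points of the graph in between make the inequality strict. *)
have [a [c [ac /andP[xa ax']]]] := Gd _ _ x0 xx' x'1.
have [b [d [bd /andP[ab bx']]]] := Gd _ _ (le_trans x0 (ltW xa)) ax' x'1.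
apply: (@le_lt_trans _ _ c); last first.
  by apply: lt_le_trans (graph_sup_ub bd (ltW bx')); rewrite -(Gm _ _ _ _ ac bd).
apply: graph_sup_le => // z y zy zx; apply/ltW; rewrite -(Gm _ _ _ _ zy ac).
exact: le_lt_trans xa.
Qed.

End OneSided.

(** The extension of [G] and that of its transpose are inverse to each other: if
    they were not, a point of the graph would fit between a value and what it
    ought to be. *)
Lemma homeo_of_dense_graph G :
    monotone_graph G -> monotone_graph (fun y x => G x y) ->
  exists f : homeo (unit_itv R), increasing f /\
    forall x y, G x y -> act f x = y.
Proof.
move=> GM GM'; have [f fE] : exists f : homeo (unit_itv R),
    forall x, 0 <= x <= 1 -> act f x = graph_sup G x.
  apply: homeo_of_increasing; [exact: graph_sup_itv|exact: graph_sup_lt|].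
  move=> y yI; have xI := graph_sup_itv GM' yI.
  exists (graph_sup (fun y x => G x y) y) => //; have /andP[y0 y1] := yI.
  set x := graph_sup _ y in xI *; have /andP[x0 x1] := xI.
  case: (ltgtP (graph_sup G x) y) => // [xy|yx].
    have [a [b [ab /andP[h1 h2]]]] : exists a b, G b a /\ graph_sup G x < a < y.
      case: GM' => _ _ _ _; apply=> //.
      by have /andP[] := graph_sup_itv GM xI.
    have bI : 0 <= b <= 1 by case: GM => _ _ /(_ _ _ ab)[].
    have : b < x.
      rewrite -(graph_supE GM' ab); apply: graph_sup_lt => //.
      by case: GM => _ _ /(_ _ _ ab)[_ /andP[]].
    case/andP: bI => b0 b1 /(graph_sup_lt GM b0)/(_ x1).
    by rewrite (graph_supE GM ab) => /lt_trans/(_ h1); rewrite ltxx.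
  have [a [b [ab /andP[h1 h2]]]] : exists a b, G b a /\ y < a < graph_sup G x.
    case: GM' => _ _ _ _; apply=> //.
    by have /andP[] := graph_sup_itv GM xI.
  have bI : 0 <= b <= 1 by case: GM => _ _ /(_ _ _ ab)[].
  have : x < b.
    rewrite -(graph_supE GM' ab); apply: graph_sup_lt => //.
    by case: GM => _ _ /(_ _ _ ab)[_ /andP[]].
  case/andP: bI => b0 b1 /(graph_sup_lt GM x0)/(_ b1).
  by rewrite (graph_supE GM ab) => /(lt_trans h2); rewrite ltxx.
exists f; split=> [x y x0 xy y1|x y xy].
  by rewrite !fE ?graph_sup_lt //; lra.
by rewrite fE ?(graph_supE GM xy) //; case: GM => _ _ /(_ _ _ xy)[].
Qed.

End DenseExtension.

Section AdicDense.
Context {R : realType} (m : nat).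
Hypothesis m_gt1 : (1 < m)%N.
Implicit Types (u v : R).

(** With [d = m - 1] this provides adic points of any prescribed residue [c]. *)
Lemma adic_dense d c u v : (c < d)%N -> 0 <= u -> u < v -> v <= 1 ->
  exists k a, (d * a + c < m ^ k)%N /\ u < adic m k (d * a + c) < v.
Proof.
move=> cd u0 uv v1; have vu : 0 < v - u by rewrite subr_gt0.
have dR : 0 < (d%:R : R) by rewrite ltr0n (leq_ltn_trans _ cd).
have cR : (c%:R : R) < d%:R by rewrite ltr_nat.
have cR0 : 0 <= (c%:R : R) by [].
have [k kE] : exists k : nat, 2 * d%:R * (v - u)^-1 < m%:R ^+ k.
  exists (Num.bound (2 * d%:R * (v - u)^-1)).
  apply: lt_trans (archi_boundP _) _; first by rewrite !mulr_ge0 ?invr_ge0 ?ltW.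
  by rewrite -natrX ltr_nat ltn_expl.
have k0 := @expm_gt0 R m m_gt1 k.
rewrite ltr_pdivrMr // mulrC in kE.
have [] := andP (@truncn_itv R (u * m%:R ^+ k / d%:R) _).
  by rewrite divr_ge0 ?mulr_ge0 // ltW.
set a := Num.truncn _; rewrite ler_pdivlMr // ltr_pdivrMr // -natr1 => aE1 aE2.
have ua : u < adic m k (d * a.+1 + c).
  by rewrite /adic ltr_pdivlMr // natrD natrM -natr1; lra.
have av : adic m k (d * a.+1 + c) < v.
  by rewrite /adic ltr_pdivrMr // natrD natrM -natr1; lra.
exists k, a.+1; split; last by rewrite ua.
by rewrite -(@adic_lt R m m_gt1 k) adic1 // (lt_le_trans av).
Qed.

End AdicDense.

Lemma last_descendant B k b m r : (b < B ^ k)%N -> (r < B ^ m)%N ->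
  ((b * B ^ m + r).+1 == B ^ (k + m))%N =
  (b.+1 == B ^ k)%N && (r.+1 == B ^ m)%N.
Proof.
move=> bk rm; rewrite expnD -addnS.
apply/eqP/andP => [H|[/eqP <- /eqP ->]]; last by rewrite mulSnr.
suff bE : b.+1 == (B ^ k)%N.
  by split=> //; rewrite -(eqn_add2l (b * B ^ m)) H -(eqP bE) mulSnr.
rewrite eqn_leq bk /= leqNgt; apply/negP => bk'.
have : (b.+2 * B ^ m <= B ^ k * B ^ m)%N by rewrite leq_mul2r bk' orbT.
rewrite -H mulSn addnC mulSn addnC.
by have : (0 < B ^ m)%N by [exact: leq_ltn_trans rm]; lia.
Qed.

(** * The subdivision tree *)
Section Subdivision.
Variable n : nat.
Hypothesis n_gt1 : (1 < n)%N.
Local Open Scope nat_scope.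

(** The number of pieces of a node: [n - 1] of length [1/n] and [n] of length
    [1/n^2]. *)
Definition arity := 2 * n - 1.
Local Notation N := arity.

Lemma arity_gt1 : 1 < N. Proof. rewrite /N; lia. Qed.
Lemma arity_mod : N = 1 %[mod n.-1].
Proof.
have -> : N = 2 * n.-1 + 1 by rewrite /N; lia.
by rewrite modnMDl.
Qed.
Lemma arity_exp_mod m : N ^ m = 1 %[mod n.-1].
Proof.
by elim: m => // m IH; rewrite expnS -modnMmr IH modnMmr muln1 arity_mod.
Qed.

(** The [j]-th cut of a node, in units of [1/n^2] of its length, when it is the
    piece of index [i] that is cut again. *)
Definition cut_pos i j :=
  if j <= i then j * n else
  if j <= i + n then i * n + (j - i) else (j - n.-1) * n.

Lemma cut_pos0 i : cut_pos i 0 = 0. Proof. by []. Qed.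

Lemma cut_pos_arity i : i < n -> cut_pos i N = n ^ 2.
Proof.
move=> i_n; rewrite /cut_pos /N; case: leqP => h1; first lia.
case: leqP => h2; last by have -> : 2 * n - 1 - n.-1 = n by lia.
have -> : i = n.-1 by lia.
nia.
Qed.

Lemma cut_posS i j : j < N -> i < n ->
  cut_pos i j.+1 = cut_pos i j + (if (i <= j < i + n) then 1 else n).
Proof.
rewrite /cut_pos /N => jN i_n; have [ji|ij] := ltnP j i.
  by rewrite (ltnW ji) mulSn addnC.
have [jin|inj] := ltnP j (i + n).
  rewrite /= (ltnW jin).
  by have [ji|ji] := leqP j i; [have -> : j = i by lia|]; lia.
rewrite /=; have -> : (j <= i) = false by lia.
have -> : j.+1 - n.-1 = (j - n.-1).+1 by lia.
have [jE|_] := leqP j (i + n); last by rewrite mulSn addnC.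
have -> : j = i + n by lia.
have -> : i + n - n.-1 = i.+1 by lia.
by rewrite !mulSn; lia.
Qed.

Lemma cut_pos_mod i j : cut_pos i j = j %[mod n.-1].
Proof.
have nE x : x * n = x * n.-1 + x by nia.
rewrite /cut_pos; case: leqP => h1; first by rewrite nE modnMDl.
case: leqP => h2.
  have -> : i * n + (j - i) = i * n.-1 + j by rewrite nE; lia.
  by rewrite modnMDl.
have -> : (j - n.-1) * n = (j - n) * n.-1 + j.
  have -> : j - n.-1 = (j - n).+1 by lia.
  by rewrite nE mulSn; lia.
by rewrite modnMDl.
Qed.

(** The piece to be cut again, for the interval of index [a] among [B^l].  The
    value is such that the left end of that piece has residue [n - 2] in all
    cases: intervals touching [1] have left end of residue [0], and
    [c + (n - 2 - c)] and [(n - 2) + (n - 1)] are both [n - 2] modulo [n - 1].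
    A node touching [1] must not cut its last piece, even when [n = 2]:
    otherwise slopes at [1] would be powers of [n^2] only.

    Nodes use [B = N]; the value for [B = n] tells how colours of cells
    evolve, see [color_child]. *)
Definition split_child B l a :=
  if a.+1 == B ^ l then n - 2 else
  if a %% n.-1 == n - 2 then n.-1 else n - 2 - a %% n.-1.

Lemma split_child_lt B l a : split_child B l a < n.
Proof. by rewrite /split_child; case: ifP => // _; [lia|case: ifP => // _; lia]. Qed.

(** [tree_num l b / n^(2l)] is the left end of the node of index [b] at depth
    [l].  Each level of nodes needs at most two levels of [n]-ary subdivision,
    hence the denominator. *)
Fixpoint tree_num l b : nat :=
  if l is l'.+1 then
    let a := b %/ N in
    tree_num l' a * n ^ 2 + (tree_num l' a.+1 - tree_num l' a) * cut_pos (split_child N l' a) (b %% N)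
  else b.

Definition num_width l b := tree_num l b.+1 - tree_num l b.

Lemma tree_numS l a j : j < N ->
  tree_num l.+1 (a * N + j) = tree_num l a * n ^ 2 + num_width l a * cut_pos (split_child N l a) j.
Proof.
move=> jN; rewrite /= divnMDl ?(ltnW arity_gt1) // divn_small // addn0.
by rewrite modnMDl modn_small.
Qed.

Lemma tree_num_refine1 l a : tree_num l.+1 (a * N) = tree_num l a * n ^ 2.
Proof. by rewrite -[a * N]addn0 tree_numS ?cut_pos0 ?muln0 ?addn0 // (ltnW arity_gt1). Qed.

Lemma tree_num_refine l m a : tree_num (l + m) (a * N ^ m) = tree_num l a * n ^ (2 * m).
Proof.
elim: m => [|m IH]; first by rewrite addn0 !muln1.
by rewrite addnS expnSr mulnA tree_num_refine1 IH mulnS -mulnA -expnD addnC.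
Qed.

Lemma tree_num_lt_width l a : tree_num l a < tree_num l a.+1 /\ exists e, num_width l a = n ^ e.
Proof.
elim: l a => [|l IH] a.
  by split=> //; exists 0; rewrite /num_width /= subSnn.
have [lt_a [e wE]] := IH (a %/ N).
have jN : a %% N < N by rewrite ltn_mod (ltnW arity_gt1).
have iN := split_child_lt N l (a %/ N).
have step : tree_num l.+1 a.+1 = tree_num l.+1 a + num_width l (a %/ N) *
    (if split_child N l (a %/ N) <= a %% N < split_child N l (a %/ N) + n then 1 else n).
  rewrite {2}(divn_eq a N) tree_numS // -addnA -mulnDr -cut_posS //.
  rewrite {1}(divn_eq a N) -addnS.
  have [jN1|jN1] := ltnP (a %% N).+1 N; first by rewrite tree_numS.
  have -> : (a %% N).+1 = N by lia.
  rewrite -mulSnr tree_num_refine1 cut_pos_arity // /num_width -mulnDl subnKC //.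
  exact: ltnW.
split; first by rewrite step -addn1 leq_add2l muln_gt0 wE expn_gt0; case: ifP; lia.
rewrite /num_width step addKn wE; case: ifP => _; [exists e|exists e.+1].
  by rewrite muln1.
by rewrite expnSr.
Qed.

Lemma tree_num_lt1 l a : tree_num l a < tree_num l a.+1. Proof. by have [] := tree_num_lt_width l a. Qed.

Lemma tree_num_le l : {mono tree_num l : a b / a <= b}.
Proof.
apply: leq_mono; apply: (homo_ltn (r := fun a b => a < b)) => [x y z|a].
  exact: ltn_trans.
exact: tree_num_lt1.
Qed.

Lemma tree_num_lt l : {mono tree_num l : a b / a < b}.
Proof. exact/leqW_mono/tree_num_le. Qed.

Lemma tree_num_child l a j : j <= N ->
  tree_num l.+1 (a * N + j) = tree_num l a * n ^ 2 + num_width l a * cut_pos (split_child N l a) j.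
Proof.
rewrite leq_eqVlt => /predU1P[->|]; last exact: tree_numS.
rewrite -mulSnr tree_num_refine1 cut_pos_arity ?split_child_lt // /num_width -mulnDl subnKC //.
exact/ltnW/tree_num_lt1.
Qed.

Lemma num_widthE l a : tree_num l a.+1 = tree_num l a + num_width l a.
Proof. by rewrite subnKC // ltnW // tree_num_lt1. Qed.

Lemma tree_num0 l : tree_num l 0 = 0.
Proof. by have := tree_num_refine 0 l 0; rewrite mul0n. Qed.

Lemma tree_num1 l : tree_num l (N ^ l) = n ^ (2 * l).
Proof. by have := tree_num_refine 0 l 1; rewrite !mul1n. Qed.

(** A piece counts for 1 and the piece cut again counts for [n], which is the
    same modulo [n - 1]: so node indices and numerators agree. *)
Lemma tree_num_mod l b : tree_num l b = b %[mod n.-1].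
Proof.
elim: l b => // l IH b; rewrite {1}(divn_eq b N) tree_numS ?ltn_mod ?(ltnW arity_gt1) //.
have w1 : num_width l (b %/ N) = 1 %[mod n.-1].
  apply/eqP; rewrite -(eqn_modDl (tree_num l (b %/ N))) -num_widthE IH.
  by rewrite -(modnDml (tree_num l _)) IH modnDml addn1.
rewrite -modnDm -modnMmr (exp_mod1 n_gt1) modnMmr muln1 IH.
rewrite -(modnMm (num_width _ _)) w1 modnMm mul1n cut_pos_mod modnDm.
by rewrite [in RHS](divn_eq b N) -[in RHS]modnDml -modnMmr arity_mod modnMmr muln1 modnDml.
Qed.

(** All that the choice of the piece to be cut again depends on *)
Definition same_type l a l' a' :=
  a = a' %[mod n.-1] /\ (a.+1 == N ^ l) = (a'.+1 == N ^ l').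

Lemma split_child_same l a l' a' : same_type l a l' a' -> split_child N l a = split_child N l' a'.
Proof. by move=> [e1 e2]; rewrite /split_child e1 e2. Qed.

Lemma same_type_sub l a l' a' m r : a < N ^ l -> a' < N ^ l' -> r < N ^ m ->
  same_type l a l' a' ->
  same_type (l + m) (a * N ^ m + r) (l' + m) (a' * N ^ m + r).
Proof.
move=> al al' rm [e1 e2]; split.
  by rewrite -modnDml -modnMml e1 modnMml modnDml.
by rewrite !last_descendant // e2.
Qed.

(** The cuts made below two nodes of the same type are in the same positions
    relative to these nodes, given here by [rho]. *)
Lemma tree_num_selfsimilar l a l' a' m : a < N ^ l -> a' < N ^ l' ->
    same_type l a l' a' ->
  exists rho : nat -> nat, forall r, r <= N ^ m ->
    tree_num (l + m) (a * N ^ m + r) = tree_num l a * n ^ (2 * m) + num_width l a * rho r /\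
    tree_num (l' + m) (a' * N ^ m + r) = tree_num l' a' * n ^ (2 * m) + num_width l' a' * rho r.
Proof.
move=> al al' aa'; elim: m => [|m [rho IH]].
  exists id => r; rewrite !addn0 !muln1 leq_eqVlt ltnS leqn0 => /orP[]/eqP->.
    by rewrite !addn1 !num_widthE !muln1.
  by rewrite !addn0 !muln0 !addn0.
have N0 := ltnW arity_gt1.
(* One level further down, the cut [r] lies inside the node of index [r %/ N]. *)
exists (fun r => rho (r %/ N) * n ^ 2 +
  (rho (r %/ N).+1 - rho (r %/ N)) * cut_pos (split_child N (l + m) (a * N ^ m + r %/ N)) (r %% N)).
move=> r; rewrite leq_eqVlt => /predU1P[->|rm].
  have [[E1 E2]] := IH _ (leqnn _).
  rewrite expnSr mulnK // modnMl cut_pos0 muln0 addn0 !mulnA -!mulnDl !addnS.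
  rewrite !tree_num_refine1 E1 E2 mulnS expnD; split; ring.
have r'm : r %/ N < N ^ m by rewrite ltn_divLR // -expnSr.
have [E1 E2] := IH _ (ltnW r'm); have [F1 F2] := IH _ r'm.
have jN : r %% N < N by rewrite ltn_mod.
have rE b : b * N ^ m.+1 + r = (b * N ^ m + r %/ N) * N + r %% N.
  by rewrite {1}(divn_eq r N) expnSr; ring.
have sE := split_child_same (same_type_sub al al' r'm aa').
rewrite !rE !addnS !tree_numS // -sE /num_width -!addnS F1 F2 E1 E2 !subnDl -!mulnBr mulnS expnD.
by split; ring.
Qed.

End Subdivision.

(** * Nodes as real intervals, and the homeomorphism they define *)
Section Nodes.
Context {R : realType} (n : nat).
Hypothesis n_gt1 : (1 < n)%N.
Notation N := (arity n).
Let N_gt1 : (1 < N)%N := arity_gt1 n_gt1.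
Let N_gt0 : (0 < N)%N := ltnW N_gt1.

Definition tree_pt l b : R := adic n (2 * l) (tree_num n l b).
Definition tree_width l b : R := adic n (2 * l) (num_width n l b).

Lemma tree_pt_lt l a b : (tree_pt l a < tree_pt l b) = (a < b)%N.
Proof. by rewrite adic_lt // tree_num_lt. Qed.

Lemma tree_pt_le l a b : (tree_pt l a <= tree_pt l b) = (a <= b)%N.
Proof. by rewrite adic_le // tree_num_le. Qed.

Lemma tree_pt0 l : tree_pt l 0 = 0. Proof. by rewrite /tree_pt tree_num0 // adic0. Qed.
Lemma tree_pt1 l : tree_pt l (N ^ l) = 1. Proof. by rewrite /tree_pt tree_num1 // adic1. Qed.

Lemma tree_pt_itv l b : (b <= N ^ l)%N -> 0 <= tree_pt l b <= 1.
Proof. by move=> bl; rewrite -(tree_pt0 l) -(tree_pt1 l) !tree_pt_le. Qed.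

Lemma tree_pt_refine l m a : tree_pt (l + m) (a * N ^ m) = tree_pt l a.
Proof. by rewrite /tree_pt tree_num_refine // mulnDr adic_refine. Qed.

Lemma tree_ptS l b : tree_pt l b.+1 = tree_pt l b + tree_width l b.
Proof. by rewrite /tree_pt num_widthE // adic_add. Qed.

Lemma tree_pt_cut l a j : (j <= N)%N ->
  tree_pt l.+1 (a * N + j) = tree_pt l a + tree_width l a * ((cut_pos n (split_child n N l a) j)%:R / n%:R ^+ 2).
Proof.
move=> jN; rewrite /tree_pt tree_num_child // (_ : 2 * l.+1 = 2 * l + 2)%N; last by lia.
rewrite adic_add adic_refine //; congr (_ + _).
rewrite /tree_width /adic natrM exprD; have := @expm_neq0 R n n_gt1 (2 * l).
by have := @m_neq0 R n n_gt1 => ? ?; field; apply/andP.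
Qed.

Lemma tree_width_pow l a : exists e : int, tree_width l a = n%:R ^ e.
Proof.
have [_ [e wE]] := tree_num_lt_width n_gt1 l a; exists (e%:Z - (2 * l)%N%:Z).
by rewrite exprzDr ?unitfE ?m_neq0 // powN // -!exprnP /tree_width /adic wE natrX.
Qed.

Lemma tree_width_gt0 l a : 0 < tree_width l a.
Proof. by rewrite -(ltrD2l (tree_pt l a)) addr0 -tree_ptS tree_pt_lt. Qed.

Lemma residue_tree_pt l b : residue n (tree_pt l b) = (b %% n.-1)%N.
Proof. by rewrite residue_adic // tree_num_mod. Qed.

Lemma tree_pt_selfsimilar l a l' a' m : (a < N ^ l)%N -> (a' < N ^ l')%N ->
    same_type n l a l' a' ->
  exists rho : nat -> R, forall r, (r <= N ^ m)%N ->
    tree_pt (l + m) (a * N ^ m + r) = tree_pt l a + tree_width l a * rho r /\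
    tree_pt (l' + m) (a' * N ^ m + r) = tree_pt l' a' + tree_width l' a' * rho r.
Proof.
move=> al al' aa'; have [rho H] := tree_num_selfsimilar n_gt1 m al al' aa'.
exists (fun r => (rho r)%:R / n%:R ^+ (2 * m)) => r /H[E1 E2].
have nm := @expm_neq0 R n n_gt1 (2 * m).
split; rewrite /tree_pt ?E1 ?E2 mulnDr adic_add adic_refine //; congr (_ + _).
  rewrite /tree_width /adic natrM exprD; have := @expm_neq0 R n n_gt1 (2 * l) => ?.
  by field; apply/andP.
rewrite /tree_width /adic natrM exprD; have := @expm_neq0 R n n_gt1 (2 * l') => ?.
by field; apply/andP.
Qed.

(** Every [n]-adic cell is either a node or the piece of a node that was cut
    again; in the second case it is the union of [n] consecutive nodes of
    equal lengths. *)
Definition thin_node k a l b :=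
  [/\ (b < N ^ l)%N, tree_pt l b = adic n k a & tree_pt l b.+1 = adic n k a.+1].

Definition thick_node k a l b :=
  [/\ (b + n < N ^ l)%N, b = n - 2 %[mod n.-1] &
      forall j, (j <= n)%N -> tree_pt l (b + j) = adic n k.+1 (a * n + j)].

Lemma adic_child k a j : adic n k.+1 (a * n + j) = adic n k a + j%:R / n%:R ^+ k.+1 :> R.
Proof.
have := @adic_refine R n n_gt1 k 1 a; rewrite expn1 addn1 adic_add => ->.
by [].
Qed.

Lemma cut_pos_hi i j : (i < j <= n)%N -> cut_pos n i (j + n.-1) = (j * n)%N.
Proof.
move=> /andP[ij jn]; rewrite /cut_pos.
have -> : (j + n.-1 <= i)%N = false by lia.
case: leqP => h; last by rewrite addnK.
have -> : j = i.+1 by lia.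
by rewrite mulSn; lia.
Qed.

(** Past the piece cut again, node indices are ahead of piece indices by
    [n - 1]. *)
Lemma thin_child k a l b j : thin_node k a l b -> (j < n)%N ->
  let i := split_child n N l b in
  if j == i then thick_node k.+1 (a * n + j) l.+1 (b * N + j) else
  thin_node k.+1 (a * n + j) l.+1 (b * N + if (j < i)%N then j else (j + n.-1)%N).
Proof.
move=> [bl Qb Qb1] jn i.
have wE : tree_width l b = (n%:R ^+ k)^-1.
  by apply: (addrI (tree_pt l b)); rewrite -tree_ptS Qb1 Qb adicS.
have step j' : (j' <= N)%N ->
    tree_pt l.+1 (b * N + j') = adic n k a + (n%:R ^+ k)^-1 * ((cut_pos n i j')%:R / n%:R ^+ 2).
  by move=> j'N; rewrite tree_pt_cut // Qb wE.
have nk := @expm_neq0 R n n_gt1 k.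
have n0 := @m_neq0 R n n_gt1.
have at_mul j' j'' : (j' <= N)%N -> cut_pos n i j' = (j'' * n)%N ->
    tree_pt l.+1 (b * N + j') = adic n k.+1 (a * n + j'').
  move=> j'N jE; rewrite step // adic_child jE natrM (exprS _ k).
  by congr (_ + _); field; apply/andP.
have i_n : (i < n)%N := split_child_lt n_gt1 N l b.
have last_ok j' : (j' < N)%N -> (b * N + j' < N ^ l.+1)%N.
  move=> j'N; apply: (@leq_trans (b * N + N)); first by rewrite ltn_add2l.
  by rewrite -mulSnr expnSr leq_mul2r bl orbT.
case: eqP => [jE|ji].
  rewrite jE; split.
  - have [bR|bR] := eqVneq b.+1 (N ^ l)%N.
      rewrite -addnA last_ok // /i /split_child bR eqxx /arity; lia.
    have b2 : (b.+2 <= N ^ l)%N by rewrite ltn_neqAle bR.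
    apply: (@leq_trans (b.+2 * N)); last by rewrite expnSr leq_mul2r b2 orbT.
    by rewrite !mulSn /arity; lia.
  - have bN : (b * N + i = b + i %[mod n.-1])%N.
      by rewrite -modnDml -modnMmr arity_mod // modnMmr muln1 modnDml.
    rewrite bN /i /split_child; case: eqP => [bR|_].
      have b0 : (b = 0 %[mod n.-1])%N.
        apply/eqP; rewrite -(eqn_modDr 1) addn1 bR.
        by rewrite arity_exp_mod.
      by rewrite -modnDml b0 modnDml add0n.
    case: eqP => [bE|bE]; first by rewrite modnDr -bE modn_mod.
    rewrite -modnDml subnKC //.
    have : (b %% n.-1 < n.-1)%N by rewrite ltn_mod; lia.
    lia.
  - move=> t tn; rewrite -addnA step; last by rewrite /arity; lia.
    have -> : cut_pos n i (i + t) = (i * n + t)%N.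
      by rewrite /cut_pos; case: leqP => h; [have -> : t = 0%N by lia|];
        rewrite ?addn0 // leq_add2l tn addKn.
    rewrite !adic_child -addrA natrD natrM !(exprS _ k.+1) !(exprS _ k).
    by congr (_ + _); field; apply/andP.
case: ltnP => h.
  split.
  - by apply: last_ok; rewrite /arity; lia.
  - by rewrite (at_mul _ j) //; [rewrite /arity; lia|rewrite /cut_pos ltnW].
  - rewrite -addnS (at_mul _ j.+1) ?addnS //; first by rewrite /arity; lia.
    by rewrite /cut_pos h.
have {}h : (i < j)%N by lia.
split.
- by apply: last_ok; rewrite /arity; lia.
- by rewrite (at_mul _ j) //; [rewrite /arity; lia|rewrite cut_pos_hi // h ltnW].
- rewrite -addnS (at_mul _ j.+1) ?addnS //; first by rewrite /arity; lia.
  by rewrite -addSn cut_pos_hi // ltnS (ltnW h).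
Qed.

Lemma thick_child k a l b j : thick_node k a l b -> (j < n)%N ->
  thin_node k.+1 (a * n + j) l (b + j).
Proof.
move=> [bl _ bE] jn; split; first by lia.
  by rewrite bE // ltnW.
by rewrite -!addnS bE.
Qed.

Lemma node_cases k a : (a < n ^ k)%N ->
  exists l b, thin_node k a l b \/ thick_node k a l b.
Proof.
elim: k a => [|k IH] a.
  rewrite expn0 ltnS leqn0 => /eqP ->; exists 0%N, 0%N; left.
  by split=> //; rewrite /tree_pt /adic /= !muln0.
have n0 : (0 < n)%N by exact: ltnW.
move=> al; have [|l [b H]] := IH (a %/ n)%N; first by rewrite ltn_divLR // -expnSr.
have jn : (a %% n < n)%N by rewrite ltn_mod.
rewrite (divn_eq a n); case: H => H; last first.
  by exists l, (b + a %% n)%N; left; apply: thick_child.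
have := thin_child H jn => /=; case: ifP => _ H'.
  by eexists; eexists; right; exact: H'.
by eexists; eexists; left; exact: H'.
Qed.

(** Also a cell that is not a node begins at the left end of a node. *)
Lemma tree_pt_onto k a : (a <= n ^ k)%N ->
  exists l b, (b <= N ^ l)%N /\ tree_pt l b = adic n k a.
Proof.
rewrite leq_eqVlt => /predU1P[->|/node_cases[l [b H]]].
  by exists 0%N, 1%N; rewrite adic1 // -(tree_pt1 0).
case: H => [[bl bE _]|[bl _ bE]]; exists l, b; first by rewrite ltnW.
split; first lia.
by have := bE 0%N (leq0n n); rewrite addn0 adic_child mul0r addr0.
Qed.

Definition tree_graph (x y : R) :=
  exists l b, [/\ (b <= N ^ l)%N, x = adic N l b & y = tree_pt l b].

Lemma tree_graph_mono x y x' y' : tree_graph x y -> tree_graph x' y' -> (x < x') = (y < y').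
Proof.
move=> [l [b [_ -> ->]]] [l' [b' [_ -> ->]]].
rewrite -(adic_refine N_gt1 l l') -(adic_refine N_gt1 l' l) addnC adic_lt //.
by rewrite -(tree_pt_refine l l') -(tree_pt_refine l' l) addnC tree_pt_lt.
Qed.

Lemma subdivision_homeo : exists th : homeo (unit_itv R), increasing th /\
  forall l b, (b <= N ^ l)%N -> act th (adic N l b) = tree_pt l b.
Proof.
have G0 : tree_graph 0 0 by exists 0%N, 0%N; rewrite adic0 tree_pt0.
have G1 : tree_graph 1 1 by exists 0%N, 1%N; split; rewrite ?adic1 // -?(tree_pt1 0) // /adic divr1.
have GI x y : tree_graph x y -> 0 <= x <= 1 /\ 0 <= y <= 1.
  by move=> [l [b [bl -> ->]]]; split; [exact: adic_itv|exact: tree_pt_itv].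
have [||th [thi thE]] := @homeo_of_dense_graph R tree_graph.
- split=> //; first by move=> x y x' y'; exact: tree_graph_mono.
  move=> u v u0 uv v1.
  have [k [a [ak auv]]] := adic_dense N_gt1 (isT : (0 < 1)%N) u0 uv v1.
  exists (adic N k (1 * a + 0)), (tree_pt k (1 * a + 0)); split=> //.
  by exists k, (1 * a + 0)%N; split=> //; exact: ltnW.
- split=> //; first by move=> x y /GI[].
    by move=> x y x' y' h h'; rewrite (tree_graph_mono h h').
  move=> u v u0 uv v1.
  have [k [a [ak auv]]] := adic_dense n_gt1 (isT : (0 < 1)%N) u0 uv v1.
  have [l [b [bl bE]]] := tree_pt_onto (ltnW ak).
  by exists (tree_pt l b), (adic N l b); split; [exists l, b|rewrite bE].
by exists th; split=> // l b bl; apply: thE; exists l, b.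
Qed.

End Nodes.

(** * Affine maps between nodes and between cells *)

(** If [F x] were off the line, monotonicity would fail between [x] and a dense
    point that lies before the line takes the value [F x]. *)
Lemma affine_of_dense (R : realType) (F : R -> R) (u v s c : R) :
    0 < s -> (forall x y, u <= x -> x < y -> y <= v -> F x < F y) ->
    F u = s * u + c -> F v = s * v + c ->
    (forall x y, u <= x -> x < y -> y <= v ->
       exists2 z, x < z < y & F z = s * z + c) ->
  forall x, u <= x <= v -> F x = s * x + c.
Proof.
move=> s0 Finc Fu Fv Fd x /andP[ux xv].
have [->//|xu] := eqVneq x u; have [->//|xv'] := eqVneq x v.
have {}ux : u < x by rewrite lt_neqAle eq_sym xu.
have {xv'}xv : x < v by rewrite lt_neqAle xv'.
case: (ltgtP (F x) (s * x + c)) => // h.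
  pose y := Num.max u ((F x - c) / s).
  have yx : y < x by rewrite /y gt_max ux ltr_pdivrMr // ltrBlDr mulrC.
  have uy : u <= y by rewrite le_max lexx.
  have [z /andP[yz zx] zE] := Fd y x uy yx (ltW xv).
  have := Finc z x (le_trans uy (ltW yz)) zx (ltW xv); rewrite zE ltNge.
  suff -> : F x <= s * z + c by [].
  rewrite -lerBlDr mulrC -ler_pdivrMr //.
  by apply: le_trans (ltW yz); rewrite le_max lexx orbT.
pose y := Num.min v ((F x - c) / s).
have xy : x < y by rewrite /y lt_min xv ltr_pdivlMr // ltrBrDr mulrC.
have yv : y <= v by rewrite ge_min lexx.
have [z /andP[xz zy] zE] := Fd x y (ltW ux) xy yv.
have := Finc x z (ltW ux) xz (ltW (lt_le_trans zy yv)); rewrite zE ltNge.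
suff -> : s * z + c <= F x by [].
rewrite -lerBrDr mulrC -ler_pdivlMr //.
by apply: (le_trans (ltW zy)); rewrite ge_min lexx orbT.
Qed.

Lemma grid_map_adic (R : realType) m (f : homeo (unit_itv R)) l a l' a' j r :
    (1 < m)%N -> (r <= m ^ j)%N -> grid_map m f l a l' a' ->
  act f (adic m (l + j) (a * m ^ j + r)) = adic m (l' + j) (a' * m ^ j + r).
Proof.
by move=> m1 rm H; rewrite !adic_nested // H // adic_itv.
Qed.

Section Transport.
Context {R : realType} (n : nat).
Hypothesis n_gt1 : (1 < n)%N.
Notation N := (arity n).
Let N_gt1 : (1 < N)%N := arity_gt1 n_gt1.
Notation tree_pt := (@tree_pt R n).
Notation tree_width := (@tree_width R n).
Variable th : homeo (unit_itv R).
Hypothesis th_inc : increasing th.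
Hypothesis thE : forall l b, (b <= N ^ l)%N -> act th (adic N l b) = tree_pt l b.

Lemma thVE l b : (b <= N ^ l)%N -> act th^-1%g (tree_pt l b) = adic N l b.
Proof. by move=> bl; rewrite -thE // actK // adic_itv. Qed.

(** The refinement of the residue modulo [n - 1] that the conjugate of [F_N]
    preserves, see [color_mod] and [color_conj] *)
Definition color y : nat := residue N (act th^-1%g y).

Lemma color_tree_pt l b : (b <= N ^ l)%N -> color (tree_pt l b) = (b %% N.-1)%N.
Proof. by move=> bl; rewrite /color thVE // residue_adic. Qed.

Lemma tree_pt_of_Zinv y : 0 <= y <= 1 -> Zinv n y ->
  exists l b, (b <= N ^ l)%N /\ tree_pt l b = y.
Proof.
by move=> yI /(adicP n_gt1 yI)[k [a [ak ->]]]; exact: tree_pt_onto.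
Qed.

Lemma Zinv_thV y : 0 <= y <= 1 -> Zinv n y -> Zinv N (act th^-1%g y).
Proof.
move=> yI /(tree_pt_of_Zinv yI)[l [b [bl <-]]]; rewrite thVE //; exact: Zinv_adic.
Qed.

Lemma arityE : N.-1 = (2 * n.-1)%N. Proof. by rewrite /arity; lia. Qed.

Lemma color_mod y : 0 <= y <= 1 -> Zinv n y ->
  (color y %% n.-1)%N = residue n y.
Proof.
move=> yI /(tree_pt_of_Zinv yI)[l [b [bl <-]]].
by rewrite color_tree_pt // residue_tree_pt // arityE modn_dvdm // dvdn_mull.
Qed.

Lemma tree_pt_dense l a x y : (a < N ^ l)%N ->
    tree_pt l a <= x -> x < y -> y <= tree_pt l a.+1 ->
  exists m r, (r <= N ^ m)%N /\ x < tree_pt (l + m) (a * N ^ m + r) < y.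
Proof.
move=> al ax xy ya.
have xI : 0 <= x <= 1.
  have := @tree_pt_itv R n n_gt1 l a (ltnW al); have := @tree_pt_itv R n n_gt1 l a.+1 al; lra.
have yI : 0 <= y <= 1.
  have := @tree_pt_itv R n n_gt1 l a (ltnW al); have := @tree_pt_itv R n n_gt1 l a.+1 al; lra.
have [k [b [bk /andP[xb by_]]]] := @adic_dense R N N_gt1 1 0 (act th^-1%g x)
  (act th^-1%g y) isT ltac:(by case/andP: (act_itv th^-1%g x))
  ltac:(by rewrite (act_ltE (increasingV th_inc))) ltac:(by case/andP: (act_itv th^-1%g y)).
rewrite mul1n addn0 in bk xb by_.
have xQ : x < tree_pt k b.
  rewrite -thE ?(ltnW bk) // -[ltLHS](actVK th xI) act_ltE ?act_itv //.
  exact: adic_itv (ltnW bk).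
have Qy : tree_pt k b < y.
  rewrite -thE ?(ltnW bk) // -[ltRHS](actVK th yI) act_ltE ?act_itv //.
  exact: adic_itv (ltnW bk).
have ab : (a * N ^ k < b * N ^ l)%N.
  rewrite -(@tree_pt_lt R n n_gt1 (l + k)) tree_pt_refine // addnC tree_pt_refine //.
  exact: le_lt_trans xQ.
have ba : (b * N ^ l < a.+1 * N ^ k)%N.
  rewrite -(@tree_pt_lt R n n_gt1 (l + k)) [in ltRHS]tree_pt_refine // addnC tree_pt_refine //.
  exact: lt_le_trans ya.
exists k, (b * N ^ l - a * N ^ k)%N; split.
  by rewrite leq_subLR addnC -mulSn ltnW.
by rewrite subnKC ?(ltnW ab) // addnC tree_pt_refine // xQ.
Qed.

Lemma node_index l m a r : (a < N ^ l)%N -> (r <= N ^ m)%N ->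
  (a * N ^ m + r <= N ^ (l + m))%N.
Proof.
move=> al rm; rewrite expnD (leq_trans (n := a.+1 * N ^ m)) //.
  by rewrite mulSnr leq_add2l.
by rewrite leq_mul2r al orbT.
Qed.

Lemma adic_nested_dense l a (x y : R) : (a < N ^ l)%N ->
    adic N l a <= x -> x < y -> y <= adic N l a.+1 ->
  exists m r, (r <= N ^ m)%N /\ x < adic N (l + m) (a * N ^ m + r) < y.
Proof.
move=> al ax xy ya; have aI := @adic_itv R N N_gt1 l a (ltnW al).
have aI' := @adic_itv R N N_gt1 l a.+1 al.
have xI : 0 <= x <= 1 by lra.
have yI : 0 <= y <= 1 by lra.
have [|||m [r [rm rE]]] := @tree_pt_dense l a (act th x) (act th y) al.
- by rewrite -thE ?(ltnW al) // act_leE.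
- by rewrite act_ltE.
- by rewrite -thE // act_leE.
have bI := node_index al rm; have kI := @adic_itv R N N_gt1 _ _ bI.
exists m, r; split=> //; move: rE; rewrite -thE // => /andP[].
by rewrite !act_ltE // => -> ->.
Qed.

(** [g] is affine from the node [(l, a)] onto the node [(l', a')]. *)
Definition node_map (g : homeo (unit_itv R)) l a l' a' :=
  forall y, tree_pt l a <= y <= tree_pt l a.+1 ->
    act g y = tree_pt l' a' + tree_width l' a' / tree_width l a * (y - tree_pt l a).

Lemma grid_map_affine m (f : homeo (unit_itv R)) l a l' a' : (1 < m)%N -> (a < m ^ l)%N ->
  grid_map m f l a l' a' -> affine_on m (act f) (adic m l a) (adic m l a.+1).
Proof.
move=> m1 al H; exists (l%:Z - l'%:Z), (adic m l' a' - m%:R ^ (l%:Z - l'%:Z) * adic m l a).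
move=> x /andP[ax xa].
have ml := @expm_gt0 R m m1 l; have ml0 := lt0r_neq0 ml.
have ml'0 := @expm_neq0 R m m1 l'.
have := H ((x - adic m l a) * m%:R ^+ l).
rewrite mulfK // addrCA subrr addr0 => ->.
  by rewrite exprzDr ?unitfE ?m_neq0 // powN // -!exprnP; field.
rewrite mulr_ge0 ?subr_ge0 ?(ltW ml) //= -ler_pdivlMr //.
by rewrite lerBlDl mul1r -adicS.
Qed.

Section Pair.
Variables (f g : homeo (unit_itv R)) (l a l' a' : nat).
Hypotheses (f_inc : increasing f) (gE : g = (th * f * th^-1)%g).
Hypotheses (al : (a < N ^ l)%N) (al' : (a' < N ^ l')%N).
Hypothesis aa' : same_type n l a l' a'.

(** By self-similarity [th] matches the cuts below both nodes, so affine maps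
    between [N]-adic cells and between nodes correspond to each other on dense
    sets of points. *)
Lemma node_map_of_grid_map : grid_map N f l a l' a' -> node_map g l a l' a'.
Proof.
move=> H; pose s := tree_width l' a' / tree_width l a.
have w0 := @tree_width_gt0 R n n_gt1 l a; have w0' := @tree_width_gt0 R n n_gt1 l' a'.
have wn := lt0r_neq0 w0.
have g_inc : increasing g.
  by rewrite gE; do 2?[apply: increasingM] => //; exact: increasingV.
have unit_adic m r : (r <= N ^ m)%N -> act g (tree_pt (l + m) (a * N ^ m + r)) =
    s * tree_pt (l + m) (a * N ^ m + r) + (tree_pt l' a' - s * tree_pt l a).
  move=> rm; rewrite gE !actM thVE ?node_index // (grid_map_adic N_gt1 rm H).
  rewrite thE ?node_index //.
  have [rho E] := @tree_pt_selfsimilar R n n_gt1 l a l' a' m al al' aa'.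
  by have [-> ->] := E r rm; rewrite /s; field.
have /andP[a0 _] := @tree_pt_itv R n n_gt1 l a (ltnW al).
have /andP[_ a1] := @tree_pt_itv R n n_gt1 l a.+1 al.
move=> y yI; rewrite (@affine_of_dense R (act g) (tree_pt l a) (tree_pt l a.+1) s
  (tree_pt l' a' - s * tree_pt l a)) //; first by rewrite /s; ring.
- exact: divr_gt0.
- by move=> x z ax xz za; apply: g_inc => //; [exact: le_trans ax|exact: le_trans a1].
- by have := unit_adic 0%N 0%N isT; rewrite !addn0 muln1.
- by have := unit_adic 0%N 1%N isT; rewrite !addn0 muln1 addn1.
- move=> x z ax xz za; have [m [r [rm rE]]] := tree_pt_dense al ax xz za.
  by exists (tree_pt (l + m) (a * N ^ m + r)) => //; exact: unit_adic.
Qed.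

Lemma grid_map_of_node_map : node_map g l a l' a' -> grid_map N f l a l' a'.
Proof.
move=> H; pose s : R := N%:R ^+ l / N%:R ^+ l'.
have Nl := @expm_gt0 R N N_gt1 l; have Nl' := @expm_gt0 R N N_gt1 l'.
have wn := lt0r_neq0 (@tree_width_gt0 R n n_gt1 l a).
have aI := @adic_itv R N N_gt1 l a (ltnW al).
have aI' := @adic_itv R N N_gt1 l a.+1 al.
have fE : f = (th^-1 * g * th)%g by rewrite gE !mulgA mulVg mul1g mulgVK.
have unit_adic m r : (r <= N ^ m)%N -> act f (adic N (l + m) (a * N ^ m + r)) =
    s * adic N (l + m) (a * N ^ m + r) + (adic N l' a' - s * adic N l a).
  move=> rm; have [rho E] := @tree_pt_selfsimilar R n n_gt1 l a l' a' m al al' aa'.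
  have [E1 E2] := E r rm.
  rewrite fE !actM thE ?node_index // H; last first.
    rewrite -{1}(@tree_pt_refine R n n_gt1 l m) -(@tree_pt_refine R n n_gt1 l m a.+1).
    by rewrite !tree_pt_le // leq_addr mulSnr leq_add2l.
  have -> : tree_pt l' a' + tree_width l' a' / tree_width l a *
      (tree_pt (l + m) (a * N ^ m + r) - tree_pt l a) = tree_pt (l' + m) (a' * N ^ m + r).
    by rewrite E1 E2; field.
  rewrite thVE ?node_index // !adic_nested //.
  rewrite /s; have := lt0r_neq0 Nl; have := lt0r_neq0 Nl' => ? ?.
  by field; apply/andP.
move=> t tI; rewrite (@affine_of_dense R (act f) (adic N l a) (adic N l a.+1) s
  (adic N l' a' - s * adic N l a)) //.
- have := lt0r_neq0 Nl; have := lt0r_neq0 Nl' => ? ?.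
  by rewrite /s; field; apply/andP.
- exact: divr_gt0.
- by move=> x z ax xz za; apply: f_inc => //; lra.
- by have := unit_adic 0%N 0%N isT; rewrite !addn0 muln1.
- by have := unit_adic 0%N 1%N isT; rewrite !addn0 muln1 addn1.
- move=> x z ax xz za; have [m [r [rm rE]]] := adic_nested_dense al ax xz za.
  by exists (adic N (l + m) (a * N ^ m + r)) => //; exact: unit_adic.
- case/andP: tI => t0 t1; rewrite lerDl divr_ge0 ?(ltW Nl) //= adicS lerD2l.
  by rewrite -[leRHS]mul1r ler_pM2r ?invr_gt0.
Qed.

Lemma node_map_affine : node_map g l a l' a' ->
  affine_on n (act g) (tree_pt l a) (tree_pt l a.+1).
Proof.
move=> H; have [e eE] := @tree_width_pow R n n_gt1 l a.
have [e' eE'] := @tree_width_pow R n n_gt1 l' a'.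
exists (e' - e), (tree_pt l' a' - n%:R ^ (e' - e) * tree_pt l a) => y yI.
rewrite H // exprzDr ?unitfE ?m_neq0 // powN // -eE -eE'.
ring.
Qed.

End Pair.
End Transport.

(** * The conjugate of [F_N] inside [F_n] *)
Section GridMaps.
Context {R : realType} (m : nat).
Hypothesis m_gt1 : (1 < m)%N.
Variables (f : homeo (unit_itv R)) (k a l b : nat).
Hypothesis H : grid_map m f k a l b.

Lemma grid_map_left : act f (adic m k a) = adic m l b.
Proof. by have := H (t := 0); rewrite !mul0r !addr0; apply; rewrite lexx ler01. Qed.

Lemma grid_map_right : act f (adic m k a.+1) = adic m l b.+1.
Proof. by have := H (t := 1); rewrite !mul1r -!adicS; apply; rewrite lexx ler01. Qed.

Lemma grid_map_child j : (j < m)%N ->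
  grid_map m f k.+1 (a * m + j) l.+1 (b * m + j).
Proof.
move=> jm t /andP[t0 t1].
have mk := @expm_neq0 R m m_gt1 k; have ml := @expm_neq0 R m m_gt1 l.
have m0 := @m_neq0 R m m_gt1.
have := H (t := (j%:R + t) / m%:R); rewrite !adic_child // !exprS.
have -> : forall x, adic m x a + j%:R / (m%:R * m%:R ^+ x) + t / (m%:R * m%:R ^+ x) =
  adic m x a + (j%:R + t) / m%:R / m%:R ^+ x :> R.
  by move=> x; have := @expm_neq0 R m m_gt1 x => ?; field => //; apply/andP.
have -> : adic m l b + j%:R / (m%:R * m%:R ^+ l) + t / (m%:R * m%:R ^+ l) =
  adic m l b + (j%:R + t) / m%:R / m%:R ^+ l :> R.
  by field => //; apply/andP.
apply; rewrite divr_ge0 ?addr_ge0 //= ler_pdivrMr ?ltr0n 1?ltnW // mul1r.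
by apply: (le_trans (y := j.+1%:R)); [rewrite -natr1 lerD2l|rewrite ler_nat].
Qed.

Lemma grid_map_last : increasing f -> (a < m ^ k)%N -> (b < m ^ l)%N ->
  (a.+1 == m ^ k)%N = (b.+1 == m ^ l)%N.
Proof.
move=> fi ak bl; have I1 : 0 <= (1 : R) <= 1 by rewrite ler01 lexx.
apply/eqP/eqP => E; last first.
  apply/eqP; rewrite eqn_leq ak -(@adic_le R m m_gt1 k) adic1 //.
  rewrite -(act_leE fi) ?adic_itv // act_at1 // grid_map_right E.
  by rewrite adic1 ?lexx.
apply/eqP; rewrite eqn_leq bl -(@adic_le R m m_gt1 l) adic1 //.
by rewrite -grid_map_right E adic1 // act_at1 ?lexx.
Qed.

Lemma grid_map_mod : is_brown_thompson m f -> (a < m ^ k)%N ->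
  (a = b %[mod m.-1])%N.
Proof.
move=> fB ak; have := brown_thompson_residue m_gt1 fB
  (adic_itv m_gt1 (ltnW ak)) (Zinv_adic m k a).
by rewrite grid_map_left !residue_adic.
Qed.

End GridMaps.

Section Conjugation.
Context {R : realType} (n : nat).
Hypothesis n_gt1 : (1 < n)%N.
Notation N := (arity n).
Let N_gt1 : (1 < N)%N := arity_gt1 n_gt1.
Notation tree_pt := (@tree_pt R n).
Notation tree_width := (@tree_width R n).
Variable th : homeo (unit_itv R).
Hypothesis th_inc : increasing th.
Hypothesis thE : forall l b, (b <= N ^ l)%N -> act th (adic N l b) = tree_pt l b.
Notation color := (color n th).
Notation thin_node := (@thin_node R n).
Notation thick_node := (@thick_node R n).
Notation node_map := (@node_map R n).

Lemma brown_thompson_conj f : is_brown_thompson N f ->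
  is_brown_thompson n (th * f * th^-1)%g.
Proof.
move=> fB; have fi := brown_thompson_increasing fB.
have [k kE] := brown_thompson_grid N_gt1 fB.
apply: (@brown_thompson_of_pieces R n _ (tree_pt k) (N ^ k)) => [||i _|i ik].
- exact: tree_pt0.
- exact: tree_pt1.
- exact: Zinv_adic.
have [l [b [bl H]]] := kE i ik.
have ib : same_type n k i l b.
  split; last exact: grid_map_last H fi ik bl.
  have /(congr1 (modn^~ n.-1)) := grid_map_mod N_gt1 H fB ik.
  by rewrite arityE // !modn_dvdm // dvdn_mull.
apply: (node_map_affine n_gt1 (l' := l) (a' := b)).
exact: (node_map_of_grid_map n_gt1 th_inc thE fi erefl ik bl ib H).
Qed.

Lemma color_conj f y : is_brown_thompson N f -> 0 <= y <= 1 -> Zinv n y ->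
  color (act (th * f * th^-1)%g y) = color y.
Proof.
move=> fB yI yZ; rewrite /color !actM actK ?act_itv //.
apply: brown_thompson_residue => //; first exact: act_itv.
exact: Zinv_thV.
Qed.

Section Backward.
Variable g : homeo (unit_itv R).
Hypothesis gB : is_brown_thompson n g.
Let g_inc := brown_thompson_increasing gB.
Let f := (th^-1 * g * th)%g.

Let f_inc : increasing f.
Proof. by do 2?[apply: increasingM] => //; exact: increasingV. Qed.

Lemma thin_mod k a l b : thin_node k a l b -> (b = a %[mod n.-1])%N.
Proof.
move=> [_ /(congr1 (residue n)) + _].
by rewrite residue_tree_pt // residue_adic.
Qed.

Lemma thin_last k a l b : thin_node k a l b ->
  (b.+1 == N ^ l)%N = (a.+1 == n ^ k)%N.
Proof.
move=> [_ _ E]; apply/eqP/eqP => H.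
  move: E; rewrite H tree_pt1 // -(@adic1 R n n_gt1 k) => /eqP.
  by rewrite eq_le !adic_le // -eqn_leq => /eqP.
move: E; rewrite H adic1 // -(@tree_pt1 R n n_gt1 l) => /eqP.
by rewrite eq_le !tree_pt_le // -eqn_leq => /eqP.
Qed.

Lemma thin_width k a l b : thin_node k a l b -> tree_width l b = (n%:R ^+ k)^-1.
Proof.
by move=> [_ E1 E2]; apply: (addrI (tree_pt l b)); rewrite -tree_ptS // E2 E1 adicS.
Qed.

(** If a cell and its image are both nodes, these have the same type, because
    [g] preserves residues and contact with [1]. *)
Lemma thin_piece k a l b l1 b1 l2 b2 : (a < n ^ k)%N -> (b < n ^ l)%N ->
    grid_map n g k a l b -> thin_node k a l1 b1 -> thin_node l b l2 b2 ->
  affine_on N (act f) (act th^-1%g (adic n k a)) (act th^-1%g (adic n k a.+1)).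
Proof.
move=> ak bl H T1 T2.
have [b1l pt1E pt1E'] := T1; have [b2l pt2E pt2E'] := T2.
have st : same_type n l1 b1 l2 b2.
  split; first by rewrite (thin_mod T1) (thin_mod T2) (grid_map_mod n_gt1 H gB ak).
  by rewrite (thin_last T1) (thin_last T2) (grid_map_last n_gt1 H g_inc ak bl).
have gE : g = (th * f * th^-1)%g by rewrite /f !mulgA mulgV mul1g mulgK.
have nk := @expm_gt0 R n n_gt1 k; have nk0 := lt0r_neq0 nk.
have nl0 := @expm_neq0 R n n_gt1 l.
have NM : node_map g l1 b1 l2 b2.
  move=> y; rewrite pt1E pt1E' pt2E (thin_width T1) (thin_width T2) => /andP[ay ya].
  have := H ((y - adic n k a) * n%:R ^+ k).
  rewrite mulfK // addrCA subrr addr0 => ->; last first.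
    rewrite mulr_ge0 ?subr_ge0 ?(ltW nk) //= -ler_pdivlMr //.
    by rewrite lerBlDl mul1r -adicS.
  by rewrite invrK; ring.
have := grid_map_of_node_map n_gt1 th_inc thE f_inc gE b1l b2l st NM.
move=> /(grid_map_affine N_gt1 b1l).
by rewrite -pt1E -pt1E' !(thVE n_gt1 thE) // ltnW.
Qed.

Hypothesis g_color : forall y, 0 <= y <= 1 -> Zinv n y ->
  color (act g y) = color y.

Lemma thin_color k a l b : thin_node k a l b ->
  color (adic n k a) = (b %% N.-1)%N /\ color (adic n k a.+1) = (b.+1 %% N.-1)%N.
Proof. by move=> [bl <- <-]; rewrite !(color_tree_pt n_gt1 thE) // ltnW. Qed.

Lemma thick_color k a l b : thick_node k a l b ->
  color (adic n k a) = (b %% N.-1)%N /\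
  color (adic n k a.+1) = ((b + n) %% N.-1)%N.
Proof.
move=> [bl _ bE]; have := bE 0%N (leq0n n); have := bE n (leqnn n).
have := @adic_refine R n n_gt1 k 1; rewrite expn1 addn1 => ref.
rewrite !addn0 -mulSnr !ref => <- <-.
by rewrite !(color_tree_pt n_gt1 thE) //; lia.
Qed.

(** The right end of a node has the next colour, but the right end of a union of
    [n] nodes has the colour [n] steps ahead.  These differ modulo [2(n - 1)], so
    an element that preserves colours cannot map a node onto such a union. *)
Lemma thin_thick_color x y : (x = y %[mod N.-1])%N ->
  (x.+1 = y + n %[mod N.-1])%N -> False.
Proof.
move=> xy /eqP; rewrite -addn1 -modnDml xy modnDml eqn_modDl eq_sym.
rewrite eqn_mod_dvd ?(ltnW n_gt1) // arityE // => /dvdn_leq; lia.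
Qed.

(** By [thin_thick_color], cells that are unions of [n] nodes are mapped to cells
    of the same kind; they are handled one node at a time, which is why the
    pieces are taken one level below the grid of [g]. *)
Lemma brown_thompson_conjV : is_brown_thompson N f.
Proof.
have [k kE] := brown_thompson_grid n_gt1 gB.
have thVi := increasingV th_inc.
apply: (@brown_thompson_of_pieces R N _
  (fun i => act th^-1%g (adic n k.+1 i)) (n ^ k.+1)) => [||i ik|i ik].
- by rewrite adic0 act_at0.
- by rewrite adic1 // act_at1.
- by apply: (Zinv_thV n_gt1 thE); [exact: adic_itv|exact: Zinv_adic].
have n0 : (0 < n)%N := ltnW n_gt1.
have ak : (i %/ n < n ^ k)%N by rewrite ltn_divLR // -expnSr.
have jn : (i %% n < n)%N by rewrite ltn_mod.
have [l [b [bl H]]] := kE _ ak.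
have aI := @adic_itv R n n_gt1 k _ (ltnW ak).
have aI' := @adic_itv R n n_gt1 k _ ak.
have c1 := g_color aI (Zinv_adic n _ _).
have c2 := g_color aI' (Zinv_adic n _ _).
rewrite (grid_map_left H) in c1; rewrite (grid_map_right H) in c2.
have [l1 [b1 [T1|T1]]] := @node_cases R n n_gt1 _ _ ak;
  have [l2 [b2 [T2|T2]]] := @node_cases R n n_gt1 _ _ bl.
- have pI := @adic_itv R n n_gt1 _ _ (ltnW ik).
  have pI' := @adic_itv R n n_gt1 _ _ ik.
  apply: affine_onS (thin_piece ak bl H T1 T2) _ _; rewrite act_leE //.
    have := @adic_refine R n n_gt1 k 1 (i %/ n); rewrite expn1 addn1 => <-.
    by rewrite adic_le // leq_divM.
  have := @adic_refine R n n_gt1 k 1 (i %/ n).+1; rewrite expn1 addn1 => <-.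
  by rewrite adic_le // mulSnr {1}(divn_eq i n) -addnS leq_add2l.
- have [e1 e2] := thin_color T1; have [e3 e4] := thick_color T2.
  by case: (@thin_thick_color b1 b2); rewrite -?e1 -?e2 -?e3 -?e4.
- have [e1 e2] := thick_color T1; have [e3 e4] := thin_color T2.
  by case: (@thin_thick_color b2 b1); rewrite -?e1 -?e2 -?e3 -?e4.
have T1' := thick_child n_gt1 T1 jn; have T2' := thick_child n_gt1 T2 jn.
have := thin_piece _ _ (grid_map_child n_gt1 H jn) T1' T2'.
rewrite -divn_eq; apply=> //.
by rewrite expnSr (leq_trans (n := b.+1 * n)) ?leq_mul2r ?bl ?orbT // mulSnr -addnS leq_add2l.
Qed.

End Backward.
End Conjugation.

(** * Flips of colours *)
Section Flips.
Context {R : realType} (n : nat).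
Hypothesis n_gt1 : (1 < n)%N.
Notation N := (arity n).
Let N_gt1 : (1 < N)%N := arity_gt1 n_gt1.
Notation tree_pt := (@tree_pt R n).
Variable th : homeo (unit_itv R).
Hypothesis th_inc : increasing th.
Hypothesis thE : forall l b, (b <= N ^ l)%N -> act th (adic N l b) = tree_pt l b.
Notation color := (color n th).
Notation thin_node := (@thin_node R n).
Notation thick_node := (@thick_node R n).

Definition unit_adic x : Prop := 0 <= x <= 1 /\ Zinv n (x : R).

Lemma unit_adic_adic k a : (a <= n ^ k)%N -> unit_adic (adic n k a).
Proof. by move=> ak; split; [exact: adic_itv|exact: Zinv_adic]. Qed.

Lemma unit_adic_act g x : is_brown_thompson n g -> unit_adic x -> unit_adic (act g x).
Proof.
by move=> gB [xI xZ]; split; [exact: act_itv|exact: brown_thompson_Zinv].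
Qed.

Lemma color_act_mod g x : is_brown_thompson n g -> unit_adic x ->
  (color (act g x) = color x %[mod n.-1])%N.
Proof.
move=> gB px; have [gI gZ] := unit_adic_act gB px; have [xI xZ] := px.
by rewrite !(color_mod n_gt1 thE) // (brown_thompson_residue n_gt1 gB xI xZ).
Qed.

Lemma color_lt y : (color y < N.-1)%N.
Proof. by rewrite ltn_mod arityE //; lia. Qed.

Definition flip g x : bool := color (act g x) != color x.

(** Both factors act on the two colours above a given residue, where flipping
    twice is doing nothing. *)
Lemma flip_act g h x : is_brown_thompson n g -> is_brown_thompson n h ->
  unit_adic x -> flip (g * h)%g x = flip g (act h x) (+) flip h x.
Proof.
move=> gB hB px; have phx := unit_adic_act hB px.
have := color_act_mod gB phx; have := color_act_mod hB px.
rewrite /flip actM; have := color_lt x; have := color_lt (act h x).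
have := color_lt (act g (act h x)); rewrite arityE //.
move: (color _) (color _) (color x) => a b c.
have two_classes u v : (u < 2 * n.-1)%N -> (v < 2 * n.-1)%N ->
    (u = v %[mod n.-1])%N -> [\/ u = v, u = v + n.-1 | v = u + n.-1]%N.
  have sub_dvd y z : (y = z %[mod n.-1] -> n.-1 %| y - z)%N.
    move=> yz; have [h1|h1] := leqP z y; first by rewrite -eqn_mod_dvd // yz.
    by rewrite (eqP (ltnW h1 : (_ - _)%N == 0%N)) dvdn0.
  move=> u2 v2 uv; have [d1 d2] := (sub_dvd _ _ uv, sub_dvd _ _ (esym uv)).
  case/dvdnP: d1 => s sE; case/dvdnP: d2 => t tE.
  case: s sE => [|[|s]] sE; case: t tE => [|[|t]] tE;
    try (by constructor 1; lia); try (by constructor 2; lia);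
    try (by constructor 3; lia); exfalso; rewrite !mulSn in sE tE; lia.
move=> a2 b2 c2 /(two_classes _ _ b2 c2) bc /(two_classes _ _ a2 b2) ab.
by case: bc => ?; case: ab => ?; case: eqP; case: eqP; case: eqP => //= *; exfalso; lia.
Qed.

Lemma thick_mod k a l b : thick_node k a l b -> (a %% n.-1 = n - 2 %[mod n.-1])%N.
Proof.
move=> [bl bm /(_ 0%N (leq0n n))/(congr1 (residue n))].
have := @adic_refine R n n_gt1 k 1 a; rewrite expn1 addn1 !addn0 => ->.
by rewrite residue_tree_pt // residue_adic // bm => ->; rewrite modn_mod.
Qed.

Lemma thick_not_last k a l b : thick_node k a l b -> (a.+1 == n ^ k)%N = false.
Proof.
move=> [bl _ /(_ n (leqnn n))]; rewrite -mulSnr.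
have := @adic_refine R n n_gt1 k 1 a.+1; rewrite expn1 addn1 => -> E.
apply/eqP => ak; move: E; rewrite ak adic1 // -(@tree_pt1 R n n_gt1 l) => /eqP.
by rewrite eq_le !tree_pt_le // -eqn_leq => /eqP; lia.
Qed.

(** The colours inside a cell do not depend on whether the cell is a node.  If
    it is not, its left end has residue [n - 2], so a node with the same left end
    cuts again its last piece; and then, up to that piece, both cut alike. *)
Lemma color_child k a j : (a < n ^ k)%N -> (j < n)%N ->
  color (adic n k.+1 (a * n + j)) = ((color (adic n k a) +
    if (j <= split_child n n k a)%N then j else (j + n.-1)%N) %% N.-1)%N.
Proof.
move=> ak jn; have [l [b [T|T]]] := @node_cases R n n_gt1 _ _ ak; last first.
  have [-> _] := thick_color n_gt1 thE T.
  have [-> _] := thin_color n_gt1 thE (thick_child n_gt1 T jn).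
  have aE : (a %% n.-1 = n - 2)%N.
    by have := thick_mod T; rewrite modn_mod => ->; apply: modn_small; lia.
  rewrite /split_child (thick_not_last T) aE eqxx.
  rewrite (_ : (j <= n.-1)%N); last by lia.
  by rewrite modnDml.
have [-> _] := thin_color n_gt1 thE T.
have slotE : split_child n N l b = split_child n n k a.
  by rewrite /split_child (thin_last n_gt1 T) (thin_mod n_gt1 T).
have N1 : (N = 1 %[mod N.-1])%N.
  by rewrite -{1}(ltn_predK N_gt1) -addn1 modnDl.
have bN x : (b * N + x = b %% N.-1 + x %[mod N.-1])%N.
  by rewrite modnDml -modnDml -modnMmr N1 modnMmr muln1 modnDml.
have := thin_child n_gt1 T jn => /=; rewrite slotE.
case: eqP => [jE|ji] H.
  by have [-> _] := thick_color n_gt1 thE H; rewrite bN jE leqnn.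
have [-> _] := thin_color n_gt1 thE H; rewrite bN (leq_eqVlt j).
by case: eqP ji.
Qed.

(** By [color_child] colours evolve alike below two cells that have the same
    residue and the same contact with [1], so they agree everywhere or nowhere;
    this makes flips constant on grid cells. *)
Lemma color_descendant k a k' a' m r : (a < n ^ k)%N -> (a' < n ^ k')%N ->
    (r < n ^ m)%N -> (a = a' %[mod n.-1])%N ->
    (a.+1 == n ^ k)%N = (a'.+1 == n ^ k')%N ->
  (color (adic n (k + m) (a * n ^ m + r)) ==
   color (adic n (k' + m) (a' * n ^ m + r))) =
  (color (adic n k a) == color (adic n k' a')).
Proof.
move=> ak a'k' rm aa' la.
elim: m r rm => [|m IH] r rm.
  by rewrite ltnS leqn0 in rm; rewrite (eqP rm) !muln1 !addn0.
have n0 : (0 < n)%N := ltnW n_gt1.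
have r'm : (r %/ n < n ^ m)%N by rewrite ltn_divLR // -expnSr.
have jn : (r %% n < n)%N by rewrite ltn_mod.
have inb x y : (x < n ^ y)%N -> (x * n ^ m + r %/ n < n ^ (y + m))%N.
  move=> xy; rewrite expnD (leq_trans (n := x.+1 * n ^ m)) //.
    by rewrite mulSnr -addnS leq_add2l.
  by rewrite leq_mul2r xy orbT.
have rE b : (b * n ^ m.+1 + r = (b * n ^ m + r %/ n) * n + r %% n)%N.
  by rewrite {1}(divn_eq r n) expnSr; ring.
rewrite !rE !addnS !color_child ?inb //.
have -> : split_child n n (k' + m) (a' * n ^ m + r %/ n) = split_child n n (k + m) (a * n ^ m + r %/ n).
  rewrite /split_child !last_descendant // la.
  have -> : (a' * n ^ m + r %/ n = a * n ^ m + r %/ n %[mod n.-1])%N.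
    by rewrite -modnDml -modnMml -aa' modnMml modnDml.
  by [].
by rewrite eqn_modDr -(IH _ r'm) !modn_small // color_lt.
Qed.

Lemma adic_cell k a x : unit_adic x -> (a < n ^ k)%N -> adic n k a <= x < adic n k a.+1 ->
  exists m r, (r < n ^ m)%N /\ x = adic n (k + m) (a * n ^ m + r).
Proof.
move=> [xI xZ] ak; have [m [c [_ ->]]] := adicP n_gt1 xI xZ.
rewrite -(adic_refine n_gt1 m k c) addnC -!(adic_refine n_gt1 k m).
rewrite adic_le // adic_lt // => /andP[ac ca].
exists m, (c * n ^ k - a * n ^ m)%N; split; last by rewrite subnKC.
by rewrite ltn_subLR // addnC -mulSn.
Qed.

(** What remains of the regularity of the flips of an element of [F_n] on a given
    grid.  It is stated for an arbitrary [d] and a fixed level [k] so that it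
    persists when runs of flips are removed. *)
Definition tame k (d : R -> bool) :=
  [/\ forall a x, (a < n ^ k)%N -> unit_adic x ->
        adic n k a <= x < adic n k a.+1 -> d x = d (adic n k a),
      forall a, (a.+1 < n ^ k)%N -> d (adic n k a.+1) != d (adic n k a) ->
        (a.+1 %% n.-1 = 0)%N,
      d 0 = false & d (adic n k (n ^ k).-1) = false].

Lemma color_last k a l b : thin_node k a l b -> (a.+1 = n ^ k)%N ->
  color (adic n k a) = 0%N.
Proof.
move=> T ak; have [-> _] := thin_color n_gt1 thE T.
have /eqP bl : b.+1 == (N ^ l)%N by rewrite (thin_last n_gt1 T) ak.
have : (b + 1 = 0 + 1 %[mod N.-1])%N by rewrite addn1 bl exp_mod1.
by move/eqP; rewrite eqn_modDr => /eqP ->; rewrite mod0n.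
Qed.

Lemma node_last_thin k a : (a.+1 = n ^ k)%N -> color (adic n k a) = 0%N.
Proof.
move=> ak; have [|l [b [T|T]]] := @node_cases R n n_gt1 k a; first by rewrite -ak.
  exact: color_last T ak.
by have := thick_not_last T; rewrite ak eqxx.
Qed.

(** The cells that are not nodes end at a point of residue [0]. *)
Lemma node_thin k a : (a < n ^ k)%N -> (a.+1 %% n.-1 != 0)%N ->
  exists l b, thin_node k a l b.
Proof.
move=> ak a1; have [l [b [T|T]]] := @node_cases R n n_gt1 k a ak.
  by exists l, b.
move: a1; rewrite -addn1 -modnDml -[(a %% _)%N]modn_mod (thick_mod T) modnDml.
by rewrite (_ : n - 2 + 1 = n.-1)%N ?modnn //; lia.
Qed.

(** Flips are constant on the cells that [g] maps affinely, by
    [color_descendant].  If the right end of such a cell has nonzero residue,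
    then the cell and its image are both nodes, so the colour of the right end is
    one ahead of that of the left end on both sides, and there is no jump. *)
Lemma flip_tame g : is_brown_thompson n g -> exists k, tame k (flip g).
Proof.
move=> gB; have gi := brown_thompson_increasing gB.
have [k kE] := brown_thompson_grid n_gt1 gB; exists k.
have nk0 : (0 < n ^ k)%N by rewrite expn_gt0 ltnW.
split.
- move=> a x ak px ax; have [l [b [bl H]]] := kE a ak.
  have [m [r [rm ->]]] := adic_cell px ak ax.
  rewrite /flip (grid_map_adic n_gt1 (ltnW rm) H) (grid_map_left H).
  rewrite color_descendant //.
    exact/esym/(grid_map_mod n_gt1 H gB ak).
  exact/esym/(grid_map_last n_gt1 H gi ak bl).
- move=> a ak; have ak' := ltnW ak; have [l [b [bl H]]] := kE a ak'.
  apply: contra_neq_eq => a1.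
  have b1 : (b.+1 %% n.-1 != 0)%N.
    by rewrite -addn1 -modnDml -(grid_map_mod n_gt1 H gB ak') modnDml addn1.
  have [l1 [c1 T1]] := node_thin ak' a1; have [l2 [c2 T2]] := node_thin bl b1.
  rewrite /flip (grid_map_left H) (grid_map_right H).
  have [-> ->] := thin_color n_gt1 thE T1.
  have [-> ->] := thin_color n_gt1 thE T2.
  by rewrite -(addn1 c1) -(addn1 c2) eqn_modDr.
- by rewrite /flip act_at0 // eqxx.
- have ak : ((n ^ k).-1 < n ^ k)%N by rewrite prednK.
  have [l [b [bl H]]] := kE _ ak.
  rewrite /flip (grid_map_left H) !node_last_thin ?eqxx ?prednK //.
  by apply/eqP; rewrite -(grid_map_last n_gt1 H gi ak bl) prednK.
Qed.

Lemma cell_of k (x : R) : 0 <= x -> x < 1 ->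
  exists a, (a < n ^ k)%N /\ adic n k a <= x < adic n k a.+1.
Proof.
move=> x0 x1.
have [||a [ak h1 h2]] := @nat_crossing (fun a => adic n k a <= x) (n ^ k).
- by rewrite adic0.
- by rewrite adic1 // -ltNge.
by exists a; split=> //; rewrite h1 ltNge.
Qed.

Lemma unflipped_conj g : is_brown_thompson n g ->
  (forall x, unit_adic x -> flip g x = false) ->
  is_brown_thompson N (th^-1 * g * th)%g.
Proof.
move=> gB g0; apply: (brown_thompson_conjV n_gt1 th_inc thE gB) => y yI yZ.
by apply/eqP; rewrite -[_ == _]negbK -/(flip g y) g0.
Qed.

Lemma flip_conj f x : is_brown_thompson N f -> unit_adic x ->
  flip (th * f * th^-1)%g x = false.
Proof.
by move=> fB [xI xZ]; rewrite /flip (color_conj n_gt1 thE) ?eqxx.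
Qed.

End Flips.

(** * Subgroups containing the conjugate of [F_N] *)
Lemma interval_step a s t : a.+1 != s -> a.+1 != t ->
  (s <= a.+1 < t)%N = (s <= a < t)%N.
Proof. lia. Qed.

Section Maximality.
Context {R : realType} (n : nat).
Hypothesis n_gt1 : (1 < n)%N.
Notation N := (arity n).
Let N_gt1 : (1 < N)%N := arity_gt1 n_gt1.
Notation tree_pt := (@tree_pt R n).
Variable th : homeo (unit_itv R).
Hypothesis th_inc : increasing th.
Hypothesis thE : forall l b, (b <= N ^ l)%N -> act th (adic N l b) = tree_pt l b.
Notation color := (color n th).
Notation flip := (flip n th).
Notation unit_adic := (@unit_adic R n).

Implicit Types (p r u v w x y z : R).

Variable K : homeo (unit_itv R) -> Prop.
Hypothesis KB : forall g, K g -> is_brown_thompson n g.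
Hypothesis KM : forall f g, K f -> K g -> K (f * g)%g.
Hypothesis KV : forall f, K f -> K f^-1%g.
Hypothesis KH : forall f, is_brown_thompson N f -> K (th * f * th^-1)%g.

Let th_incV : increasing th^-1%g := increasingV th_inc.

(** [move_point] for [F_N], seen through [th]: colours play the role of
    residues. *)
Lemma color_move c d x y : 0 <= c -> d <= 1 -> c < x < d -> c < y < d ->
    Zinv n c -> Zinv n d -> Zinv n x -> Zinv n y -> color x = color y ->
  exists h, [/\ K h, forall z, unit_adic z -> flip h z = false, act h x = y &
    forall t, 0 <= t <= 1 -> t <= c \/ d <= t -> act h t = t].
Proof.
move=> c0 d1 /andP[cx xd] /andP[cy yd] cZ dZ xZ yZ xy.
have cI : 0 <= c <= 1 by lra.
have dI : 0 <= d <= 1 by lra.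
have xI : 0 <= x <= 1 by lra.
have yI : 0 <= y <= 1 by lra.
have ZV z : 0 <= z <= 1 -> Zinv n z -> Zinv N (act th^-1%g z).
  exact: Zinv_thV.
have [||||||||f [fB fx ft]] := @move_point R N N_gt1 (act th^-1%g c) (act th^-1%g d)
  (act th^-1%g x) (act th^-1%g y).
- by case/andP: (act_itv th^-1%g c).
- by case/andP: (act_itv th^-1%g d).
- by rewrite !act_ltE // cx.
- by rewrite !act_ltE // cy.
- exact: ZV.
- exact: ZV.
- exact: ZV.
- by apply/residueP => //; [exact: act_itv|exact: act_itv|exact: ZV|exact: ZV].
exists (th * f * th^-1)%g; split; first exact: KH.
- by move=> z; exact: (flip_conj n_gt1 thE).
- by rewrite !actM fx actVK.
- move=> t tI tcd; rewrite !actM ft ?actVK ?act_itv // !act_leE //.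
Qed.

Definition flips_on y1 y2 :=
  exists2 k, K k & forall x, unit_adic x -> flip k x = (y1 <= x < y2).

Definition residue0 y := [/\ 0 < y < 1, Zinv n y & residue n y = 0%N].

Lemma residue0_unit_adic y : residue0 y -> unit_adic y.
Proof. by move=> [/andP[y0 y1] yZ _]; split=> //; rewrite !ltW. Qed.

Lemma residue0_act g y : is_brown_thompson n g -> residue0 y -> residue0 (act g y).
Proof.
move=> gB By; have [yI yZ] := residue0_unit_adic By; have gi := brown_thompson_increasing gB.
have [/andP[y0 y1] _ ry] := By.
have I0 : 0 <= (0 : R) <= 1 by rewrite lexx ler01.
have I1 : 0 <= (1 : R) <= 1 by rewrite lexx ler01.
split; last by rewrite (brown_thompson_residue n_gt1 gB).
  by rewrite -{1}(act_at0 gi) -(act_at1 gi) !act_ltE // y0.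
exact: brown_thompson_Zinv.
Qed.

(** Only two colours have residue [0]. *)
Lemma residue0_color x y z : residue0 x -> residue0 y -> residue0 z ->
  color x != color z -> color y != color z -> color x = color y.
Proof.
have two w : residue0 w -> (color w = 0 \/ color w = n.-1)%N.
  move=> Bw; have [wI wZ] := residue0_unit_adic Bw; have [_ _ rw] := Bw.
  have := color_lt n_gt1 th w; have := color_mod n_gt1 thE wI wZ.
  rewrite rw arityE // => /eqP/dvdnP[s ->]; case: s => [|[|s]].
  - by left.
  - by rewrite mul1n; right.
  - by rewrite ltn_mul2r ltnS !ltnS ltn0 andbF.
move=> /two[]-> /two[]-> /two[]->; rewrite ?eqxx //.
Qed.

Lemma color_dense u v y : 0 <= u -> u < v -> v <= 1 -> unit_adic y ->
  exists r, [/\ u < r < v, Zinv n r & color r = color y].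
Proof.
move=> u0 uv v1 [yI yZ].
have uI : 0 <= u <= 1 by lra.
have vI : 0 <= v <= 1 by lra.
have [|||k [a [ak /andP[h1 h2]]]] := @adic_dense R N N_gt1 N.-1 (color y)
  (act th^-1%g u) (act th^-1%g v) (color_lt n_gt1 th y).
- by case/andP: (act_itv th^-1%g u).
- by rewrite act_ltE.
- by case/andP: (act_itv th^-1%g v).
have aI := @adic_itv R N N_gt1 _ _ (ltnW ak).
exists (tree_pt k (N.-1 * a + color y)); split.
- rewrite -thE ?(ltnW ak) // -[u](actVK th uI) -[v](actVK th vI).
  by rewrite !act_ltE ?act_itv // h1.
- exact: Zinv_adic.
- rewrite (color_tree_pt n_gt1 thE) ?(ltnW ak) // mulnC modnMDl modn_small //.
  exact: color_lt.
Qed.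

(** Composing with an element of [H] that maps one pair to the other transports
    the interval of flips, since elements of [H] flip nothing. *)
Lemma flips_on_move y1 y2 z1 z2 : residue0 y1 -> residue0 y2 -> residue0 z1 -> residue0 z2 ->
    y1 < y2 -> z1 < z2 -> color z1 = color y1 -> color z2 = color y2 ->
  flips_on y1 y2 -> flips_on z1 z2.
Proof.
move=> By1 By2 Bz1 Bz2 y12 z12 c1 c2 [k Kk kE].
have [/andP[y10 y11] y1Z _] := By1; have [/andP[y20 y21] y2Z _] := By2.
have [/andP[z10 z11] z1Z _] := Bz1; have [/andP[z20 z21] z2Z _] := Bz2.
have [||h1 [Kh1 h1f h1E _]] := @color_move 0 1 z1 y1 (lexx _) (lexx _) _ _
  (Zinv0 n) (Zinv_one n) z1Z y1Z c1; rewrite ?z10 ?y10 //.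
have h1B := KB Kh1; have h1i := brown_thompson_increasing h1B.
have [/andP[w0 w1] wZ _] := residue0_act h1B Bz2.
have cw : color (act h1 z2) = color y2.
  have := h1f _ (residue0_unit_adic Bz2); rewrite /flip => /negbT; rewrite negbK => /eqP ->.
  exact: c2.
have yw : y1 < act h1 z2.
  by rewrite -h1E; apply: h1i => //; exact: ltW.
have [||h2 [Kh2 h2f h2E h2t]] := @color_move y1 1 (act h1 z2) y2 (ltW y10) (lexx _) _ _
  y1Z (Zinv_one n) wZ y2Z cw; rewrite ?yw ?y12 //.
have h2B := KB Kh2; have hB := is_brown_thompsonM h2B h1B.
have hi := brown_thompson_increasing hB.
exists (k * (h2 * h1))%g; first by apply: KM => //; exact: KM.
move=> x px; rewrite (flip_act n_gt1 thE) //; last exact: KB.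
rewrite (flip_act n_gt1 thE) // h1f // h2f; last exact: unit_adic_act.
rewrite addbF kE; last exact: unit_adic_act.
have e1 : y1 = act (h2 * h1)%g z1.
  by rewrite actM h1E h2t ?lexx; [|rewrite ltW //= ltW|left].
have e2 : y2 = act (h2 * h1)%g z2 by rewrite actM h2E.
have [xI _] := px; have [z1I _] := residue0_unit_adic Bz1; have [z2I _] := residue0_unit_adic Bz2.
by rewrite {1}e1 e2 act_leE ?act_ltE ?addbF.
Qed.

(** The bounds [pm] and [pp] leave room on both sides of the jump for an element
    of [H] that moves points to [p] without seeing another jump of [g]. *)
Definition up_jump g p := [/\ K g, residue0 p & exists pm pp,
  [/\ 0 <= pm < p, p < pp <= 1, Zinv n pm, Zinv n pp &
      forall x, unit_adic x -> pm <= x < pp -> flip g x = (p <= x)]].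

Lemma up_jump_exists g y : K g -> unit_adic y -> flip g y -> exists p, up_jump g p.
Proof.
move=> Kg [/andP[y0 y1] yZ] gy; have gB := KB Kg.
have gi := brown_thompson_increasing gB.
have [k [cst jmp f0 fl]] := flip_tame n_gt1 thE gB.
have {}y1 : y < 1.
  by rewrite lt_neqAle y1 andbT; apply: contraL gy => /eqP ->; rewrite /flip act_at1 // eqxx.
have [b [bk by_]] := cell_of n_gt1 k y0 y1.
have fb : flip g (adic n k b).
  by rewrite -(cst b y) //; split=> //; rewrite y0 ltW.
have [||a [ab]] := @nat_crossing (fun a => ~~ flip g (adic n k a)) b.
- by rewrite adic0 f0.
- by rewrite negbK.
rewrite negbK => na fa.
have ak : (a.+1 < n ^ k)%N by exact: leq_ltn_trans bk.
exists (adic n k a.+1); split=> //.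
  split; last by rewrite residue_adic // jmp // fa (negbTE na).
    by rewrite -(adic0 n k) -(adic1 n_gt1 k) !adic_lt.
  exact: Zinv_adic.
exists (adic n k a), (adic n k a.+2); split; try exact: Zinv_adic.
- by rewrite adic_lt // ltnSn andbT -(adic0 n k) adic_le.
- by rewrite adic_lt // ltnSn -(adic1 n_gt1 k) adic_le.
move=> x px /andP[ax xa]; case: leP => h; first by rewrite (cst a.+1) // h.
by rewrite (cst a) ?(negbTE na) // ?ax // (ltn_trans _ ak).
Qed.

(** As [h] flips nothing, [g h g^-1] flips [g y] iff [g] flips exactly one of [y]
    and [h y], that is, iff [p] separates them, which means that [y] lies
    between [r] and [p]. *)
Lemma conj_flips g p r : up_jump g p -> unit_adic r -> r != p -> color r = color p ->
    (forall pm pp, (forall x, unit_adic x -> pm <= x < pp -> flip g x = (p <= x)) ->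
      0 <= pm -> pp <= 1 -> pm < p -> p < pp -> Zinv n pm -> Zinv n pp ->
      pm < r < pp ->
  flips_on (act g (Num.min r p)) (act g (Num.max r p))).
Proof.
move=> [Kg Bp _] [rI rZ] rp rc pm pp gE pm0 pp1 pmp ppp pmZ ppZ rm.
have gB := KB Kg; have gi := brown_thompson_increasing gB.
have gVB := is_brown_thompsonV gB; have [pI pZ] := residue0_unit_adic Bp.
have [|h [Kh hf hE ht]] := @color_move pm pp r p pm0 pp1 rm _ pmZ ppZ rZ pZ rc.
  by rewrite pmp.
have hB := KB Kh; have hi := brown_thompson_increasing hB.
exists (g * h * g^-1)%g; first by apply: KM; [exact: KM|exact: KV].
move=> x px; have py := unit_adic_act n_gt1 gVB px; have [xI _] := px.
have xE : x = act g (act g^-1%g x) by rewrite actVK.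
rewrite (flip_act n_gt1 thE (is_brown_thompsonM gB hB)) // (flip_act n_gt1 thE) //.
have -> : flip g^-1%g x = flip g (act g^-1%g x).
  have := flip_act n_gt1 thE gB gVB px; rewrite mulgV /flip act1 // eqxx.
  by case: (_ != _); case: (_ != _).
have mI : 0 <= Num.min r p <= 1 by rewrite /Num.min; case: ifP.
have MI : 0 <= Num.max r p <= 1 by rewrite /Num.max; case: ifP.
have yI := act_itv g^-1%g x.
have -> : (act g (Num.min r p) <= x < act g (Num.max r p)) =
    (Num.min r p <= act g^-1%g x < Num.max r p).
  by rewrite -(act_ltE gi yI MI) -(act_leE gi mI yI) -xE.
move: (act g^-1%g x) py yI => y py yI.
have hy := unit_adic_act n_gt1 hB py; have [hyI _] := hy.
rewrite hf // addbF.
have pmI : 0 <= pm <= 1 by lra.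
have ppI : 0 <= pp <= 1 by lra.
case/andP: rm => pmr rpp.
case: (leP y pm) => ypm.
  rewrite ht //; last by left.
  by rewrite addbb /Num.min; case: ifP => _; lra.
case: (leP pp y) => ypp.
  rewrite ht //; last by right.
  by rewrite addbb /Num.max; case: ifP => _; lra.
have hyb : pm <= act h y < pp.
  rewrite -{1}(ht pm) //; last by left; rewrite lexx.
  rewrite -(ht pp) //; last by right; rewrite lexx.
  by rewrite act_leE // act_ltE // ltW.
have yb : pm <= y < pp by rewrite ypp ltW.
rewrite (gE y py yb) (gE _ hy hyb) -{1}hE act_leE //.
rewrite /Num.min /Num.max; case: ltP => h1; case: (leP r y) => h2; case: (leP p y) => h3;
  rewrite //=; lra.
Qed.

Definition pairs_flip c c' := exists y1 y2, [/\ residue0 y1, residue0 y2 & y1 < y2] /\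
  [/\ color y1 = c, color y2 = c' & flips_on y1 y2].

(** For [r] to the right of [p] both ends are flipped by [g], for [r] to the left
    only [p] is. *)
Lemma up_jump_pairs g p : up_jump g p ->
  [/\ color (act g p) != color p,
      pairs_flip (color (act g p)) (color (act g p)) &
      pairs_flip (color p) (color (act g p))].
Proof.
move=> gp; have [Kg Bp [pm [pp [/andP[pm0 pmp] /andP[ppp pp1] pmZ ppZ gE]]]] := gp.
have gB := KB Kg; have gi := brown_thompson_increasing gB.
have pt := residue0_unit_adic Bp; have [pI pZ] := pt.
have fp : flip g p by rewrite gE // ?lexx // ltW.
have rp := conj_flips gp.
have r_base r : Zinv n r -> pm < r < pp -> color r = color p -> residue0 r.
  move=> rZ rI rc; have rI' : 0 <= r <= 1 by lra.
  split=> //; first lra.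
  rewrite -(color_mod n_gt1 thE rI' rZ) rc (color_mod n_gt1 thE pI pZ).
  by have [] := Bp.
split=> //.
- have [r [/andP[h1 h2] rZ rc]] := color_dense (ltW (le_lt_trans pm0 pmp)) ppp pp1 pt.
  have Br : residue0 r by apply: r_base => //; lra.
  have rI : 0 <= r <= 1 by have [] := residue0_unit_adic Br.
  have fr : flip g r by rewrite gE; [exact: ltW|exact: residue0_unit_adic|lra].
  exists (act g p), (act g r); split.
    by split; [exact: residue0_act|exact: residue0_act|rewrite act_ltE].
  split=> //.
    by apply: (residue0_color (z := p)) => //; [exact: residue0_act|exact: residue0_act|rewrite -rc].
  have := rp r (residue0_unit_adic Br) _ rc pm pp gE pm0 pp1 pmp ppp pmZ ppZ.
  rewrite (min_idPr (ltW h1)) (max_idPl (ltW h1)); apply; last lra.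
  by rewrite gt_eqF.
- have [r [/andP[h1 h2] rZ rc]] := color_dense pm0 pmp (le_trans (ltW ppp) pp1) pt.
  have Br : residue0 r by apply: r_base => //; lra.
  have rI : 0 <= r <= 1 by have [] := residue0_unit_adic Br.
  have fr : flip g r = false.
    by rewrite gE; [lra|exact: residue0_unit_adic|lra].
  exists (act g r), (act g p); split.
    by split; [exact: residue0_act|exact: residue0_act|rewrite act_ltE].
  split=> //; first by rewrite -rc; apply/eqP; rewrite -[_ == _]negbK -/(flip g r) fr.
  have := rp r (residue0_unit_adic Br) _ rc pm pp gE pm0 pp1 pmp ppp pmZ ppZ.
  rewrite (min_idPl (ltW h2)) (max_idPr (ltW h2)); apply; last lra.
  by rewrite lt_eqF.
Qed.

(** A jump of [g] gives two of the four pairs of colours.  The element that flips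
    a pair of the first kind starts to flip at a point of the other colour than
    [p], so it gives the two remaining pairs. *)
Lemma flips_on_all g y : K g -> unit_adic y -> flip g y ->
  forall y1 y2, residue0 y1 -> residue0 y2 -> y1 < y2 -> flips_on y1 y2.
Proof.
move=> Kg py gy; have [p gp] := up_jump_exists Kg py gy.
have [np P1 P2] := up_jump_pairs gp; have [_ Bp _] := gp.
have Bgp := residue0_act (KB Kg) Bp.
set e := color (act g p) in np P1 P2; set e0 := color p in np P2.
have two z : residue0 z -> color z = e \/ color z = e0.
  move=> Bz; have [->|ze] := eqVneq (color z) e; first by left.
  by right; apply: (residue0_color Bz Bp Bgp) => //; rewrite eq_sym.
have [P3 P4] : pairs_flip e0 e0 /\ pairs_flip e e0.
  have [y1 [y2 [[B1 B2 y12] [c1 c2 [k Kk kE]]]]] := P1.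
  have [/andP[y10 y11] y1Z _] := B1; have [/andP[y20 y21] y2Z _] := B2.
  have kj : up_jump k y1.
    split=> //; exists 0, y2; split=> //; rewrite ?lexx ?y12 ?ltW //.
    - exact: Zinv0.
    - by move=> x px /andP[x0 xy]; rewrite kE // xy andbT.
  have [n1 P3 P4] := up_jump_pairs kj.
  have ky1 : color (act k y1) = e0.
    by have [E|//] := two _ (residue0_act (KB Kk) B1); rewrite E c1 eqxx in n1.
  by rewrite -ky1 -c1.
move=> z1 z2 B1 B2 z12.
have use c c' : color z1 = c -> color z2 = c' -> pairs_flip c c' -> flips_on z1 z2.
  move=> <- <- [y1 [y2 [[By1 By2 y12] [c1 c2 H]]]].
  exact: (flips_on_move By1 By2 B1 B2 y12 z12 (esym c1) (esym c2)).
by have [h1|h1] := two _ B1; have [h2|h2] := two _ B2; apply: use h1 h2 _.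
Qed.

(** Induction on the number [d] of grid cells beyond an initial segment free of
    flips: if the first of them is flipped, the run that it starts is removed by
    an element of [K] that flips exactly the image of this run. *)
Lemma subgroup_full g y : K g -> unit_adic y -> flip g y ->
  forall f, is_brown_thompson n f -> K f.
Proof.
move=> Kg py gy; have pairs := flips_on_all Kg py gy.
suff H k s d f : (s + d = n ^ k)%N -> is_brown_thompson n f -> tame n k (flip f) ->
    (forall a, (a < s)%N -> flip f (adic n k a) = false) -> K f.
  move=> f fB; have [k ft] := flip_tame n_gt1 thE fB.
  by apply: (H k 0%N (n ^ k)%N f) => //.
elim: d s f => [|d IH] s f.
  rewrite addn0 => sE fB [cst _ _ _] f0; have fi := brown_thompson_increasing fB.
  have -> : f = (th * (th^-1 * f * th) * th^-1)%g.
    by rewrite !mulgA mulgV mul1g mulgK.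
  apply/KH/(unflipped_conj n_gt1 th_inc thE fB) => x px.
  have [/andP[x0 x1] xZ] := px.
  have [->|xn] := eqVneq x 1; first by rewrite /flip act_at1 // eqxx.
  have [|a [ak ax]] := @cell_of R n n_gt1 k x x0; first by rewrite lt_neqAle xn.
  by rewrite (cst a) // f0 // sE.
move=> sE fB ft f0; have [cst jmp z0 zl] := ft.
have fi := brown_thompson_increasing fB.
have sk : (s < n ^ k)%N by rewrite -sE -addSnnS leq_addr.
have IHs := IH s.+1 _; rewrite addSnnS in IHs.
have [fs|fs] := boolP (flip f (adic n k s)); last first.
  apply: (IHs f) => // a; rewrite ltnS leq_eqVlt => /predU1P[->|]; last exact: f0.
  exact: negbTE.
have s0 : (0 < s)%N by rewrite lt0n; apply: contraL fs => /eqP ->; rewrite adic0 z0.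
have [||t [tk ft1 ft2]] := @nat_crossing (fun i => flip f (adic n k (s + i))) ((n ^ k).-1 - s).
- by rewrite addn0.
- by rewrite subnKC ?zl //; lia.
have t_k : (s + t.+1 < n ^ k)%N by lia.
have residue0_adic a : (0 < a < n ^ k)%N -> (a %% n.-1 = 0)%N -> residue0 (adic n k a).
  move=> /andP[a0 ak] am; split; last by rewrite residue_adic.
    by rewrite -(adic0 n k) -(adic1 n_gt1 k) !adic_lt // a0.
  exact: Zinv_adic.
have sm : (s %% n.-1 = 0)%N.
  have sE' := ltn_predK s0; rewrite -sE'; apply: jmp; rewrite sE' //.
  by rewrite fs f0 // -{2}sE'.
have tm : ((s + t.+1) %% n.-1 = 0)%N.
  by rewrite addnS; apply: jmp; rewrite -addnS // ft1 (negbTE ft2).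
(* The run of flipped cells starts at [s] and stops at [s + t + 1], two jumps
   of the flips of [f]. *)
have B1 : residue0 (adic n k s) by apply: residue0_adic; rewrite ?s0.
have B2 : residue0 (adic n k (s + t.+1)).
  by apply: residue0_adic tm; rewrite t_k addnS.
have [I1 _] := residue0_unit_adic B1; have [I2 _] := residue0_unit_adic B2.
have [|h Kh hE] := pairs _ _ (residue0_act fB B1) (residue0_act fB B2).
  by rewrite act_ltE // adic_lt // -{1}[s]addn0 ltn_add2l.
have hB := KB Kh; have hfB := is_brown_thompsonM hB fB.
have hfE x : unit_adic x -> flip (h * f)%g x =
    (adic n k s <= x < adic n k (s + t.+1)) (+) flip f x.
  move=> px; have [xI _] := px.
  rewrite (flip_act n_gt1 thE) // hE; last exact: unit_adic_act.
  by rewrite act_leE // act_ltE.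
have hfa a : (a <= n ^ k)%N -> flip (h * f)%g (adic n k a) =
    (s <= a < s + t.+1)%N (+) flip f (adic n k a).
  by move=> ak; rewrite hfE; [rewrite adic_le // adic_lt|exact: unit_adic_adic].
have nk0 : (0 < n ^ k)%N by exact: leq_ltn_trans sk.
suff : K (h * f)%g.
  by move=> Khf; have := KM (KV Kh) Khf; rewrite mulgA mulVg mul1g.
apply: (IHs (h * f)%g) => //.
  split.
  - move=> a x ak px ax; have [a1 a2] := andP ax.
    have cell_le i : (adic n k i <= x) = (i <= a)%N.
      apply/idP/idP => [h1|h1].
        by rewrite -ltnS -(@adic_lt R n n_gt1 k) (le_lt_trans h1).
      by rewrite (le_trans _ a1) // adic_le.
    by rewrite hfE // hfa ?(ltnW ak) // (cst a) // ltNge !cell_le -ltnNge.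
  - move=> a ak; rewrite !hfa ?(ltnW ak) //; last exact/ltnW/ltnW.
    have [->//|as1] := eqVneq a.+1 s.
    have [->//|at1] := eqVneq a.+1 (s + t.+1)%N.
    rewrite interval_step //.
    move=> H; apply: jmp => //; apply: contra_neq H => -> //.
  - have := hfa 0%N (leq0n _); rewrite adic0 => ->.
    by rewrite z0 addbF leqNgt s0.
  - rewrite hfa ?leq_pred // zl addbF (ltnNge _ (s + _)) -(ltnS (s + _)) prednK // t_k.
    by rewrite andbF.
move=> a; rewrite ltnS => a_s; rewrite hfa ?(ltnW (leq_ltn_trans a_s sk)) //.
move: a_s; rewrite leq_eqVlt => /predU1P[->|a_s].
  by rewrite leqnn fs -{1}[s]addn0 ltn_add2l.
by rewrite f0 // addbF leqNgt a_s.
Qed.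

End Maximality.

(** * The maximal subgroup *)
Section JonesSubgroup.
Context {R : realType} (n : nat).
Hypothesis n_gt1 : (1 < n)%N.
Notation N := (arity n).
Let N_gt1 : (1 < N)%N := arity_gt1 n_gt1.
Notation tree_pt := (@tree_pt R n).
Variable th : homeo (unit_itv R).
Hypothesis th_inc : increasing th.
Hypothesis thE : forall l b, (b <= N ^ l)%N -> act th (adic N l b) = tree_pt l b.
Notation color := (color n th).
Notation flip := (flip n th).
Notation unit_adic := (@unit_adic R n).
Notation residue0 := (@residue0 R n).
Notation F := (brown_thompson R).

Lemma valP_thompson m (g : F m) : is_brown_thompson m (\val g).
Proof. exact: asboolW (valP g). Qed.

Lemma thompson_lift m (g : homeo (unit_itv R)) : is_brown_thompson m g ->
  exists u : F m, \val u = g.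
Proof. by move=> gB; exists (exist _ g (asboolT gB)). Qed.

Lemma thompson_val1 m : \val (1%g : F m) = 1%g. Proof. exact: gmulf1. Qed.
Lemma thompson_valM m (f g : F m) : \val (f * g)%g = (\val f * \val g)%g.
Proof. exact: gmulfM. Qed.
Lemma thompson_valV m (f : F m) : \val f^-1%g = (\val f)^-1%g.
Proof. exact: gmulfV. Qed.

(** An analogue of Jones' subgroup of Thompson's group [F], the stabiliser of a
    colouring of the dyadic numbers with two colours *)
Definition conj_subgroup : set (F n) :=
  [set g | exists f : F N, \val g = (th * \val f * th^-1)%g].

Lemma conj_subgroupP g : conj_subgroup g <->
  forall x, unit_adic x -> flip (\val g) x = false.
Proof.
split=> [[f ->] x|g0]; first exact: (flip_conj n_gt1 thE (valP_thompson f)).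
have fB := unflipped_conj n_gt1 th_inc thE (valP_thompson g) g0.
have [f fE] := thompson_lift fB.
by exists f; rewrite fE !mulgA mulgV mul1g mulgK.
Qed.

Lemma conj_subgroup_closed : subgroup conj_subgroup.
Proof.
split=> [|g h]; rewrite !inE.
  by exists 1%g; rewrite !thompson_val1 mulg1 mulgV.
move=> [f fE] [f' f'E]; exists (f * f'^-1)%g.
rewrite thompson_valM thompson_valV fE f'E thompson_valM thompson_valV !invgM invgK !mulgA.
by rewrite mulgVK.
Qed.

Lemma residue0_tree_pt l b : (0 < b < N ^ l)%N -> (b %% n.-1 = 0)%N -> residue0 (tree_pt l b).
Proof.
move=> /andP[b0 bl] bm; split; last by rewrite residue_tree_pt.
  by rewrite -(tree_pt0 n_gt1 l) -(tree_pt1 n_gt1 l) !tree_pt_lt // b0.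
exact: Zinv_adic.
Qed.

(** Two points with residue [0] but of different colours, the ends of index
    [2(n - 1)] and [n - 1] at depth 1, are in the same orbit of [F_n]. *)
Lemma flipping_element : exists g x,
  [/\ is_brown_thompson n g, unit_adic x & flip g x].
Proof.
have B1 : residue0 (tree_pt 1 (2 * n.-1)).
  by apply: residue0_tree_pt; [rewrite expn1 /arity; lia|rewrite modnMl].
have B2 : residue0 (tree_pt 1 n.-1).
  by apply: residue0_tree_pt; [rewrite expn1 /arity; lia|rewrite modnn].
have [I1 r1Z r1] := B1; have [I2 r2Z r2] := B2.
have [|g [gB gE _]] := @move_point R n n_gt1 0 1 _ _ (lexx _) (lexx _) I1 I2
  (Zinv0 n) (Zinv_one n) r1Z.
  have [p1 _] := residue0_unit_adic B1; have [p2 _] := residue0_unit_adic B2.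
  by apply/residueP => //; rewrite r1 r2.
exists g, (tree_pt 1 (2 * n.-1)); split=> //; first exact: residue0_unit_adic.
rewrite /flip gE !(color_tree_pt n_gt1 thE) ?arityE // ?expn1 /arity; try lia.
by rewrite modnn modn_small; lia.
Qed.

Lemma conj_subgroup_proper : conj_subgroup != [set: F n].
Proof.
have [g [x [gB px gx]]] := flipping_element; have [u uE] := thompson_lift gB.
apply/eqP => H; have : conj_subgroup u by rewrite H.
by move=> /conj_subgroupP/(_ x px); rewrite uE gx.
Qed.

Lemma conj_subgroup_maximal : maximal_subgroup conj_subgroup.
Proof.
split; [exact: conj_subgroup_closed|exact: conj_subgroup_proper|].
move=> K Kg KT HK; apply/seteqP; split=> // g gK; apply/conj_subgroupP => x px.
case gx: (flip (\val g) x) => //; case/negP: KT; apply/eqP; apply/seteqP; split=> // h _.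
have KV u : K u -> K u^-1%g.
  by move=> uK; have := group_closedV Kg; move/(_ u); rewrite !inE; apply.
have KM u v : K u -> K v -> K (u * v)%g.
  by move=> uK vK; have := group_closedM Kg; move/(_ u v); rewrite !inE; apply.
pose K' (f : homeo (unit_itv R)) := exists2 u, K u & \val u = f.
have [|||||u uK uE] := @subgroup_full R n n_gt1 th th_inc thE K' _ _ _ _
  (\val g) x _ px gx (\val h) (valP_thompson h).
- by move=> f [u _ <-]; exact: valP_thompson.
- by move=> f f' [u uK <-] [v vK <-]; exists (u * v)%g; [exact: KM|rewrite thompson_valM].
- by move=> f [u uK <-]; exists u^-1%g; [exact: KV|rewrite thompson_valV].
- move=> f fB; have [u uE] := thompson_lift (brown_thompson_conj n_gt1 th_inc thE fB).
  have [v vE] := thompson_lift fB.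
  by exists u => //; apply: HK; exists v; rewrite uE vE.
- by exists g.
by rewrite -(val_inj uE).
Qed.

(** Let [u i] flip exactly [[b (i+1), b 0)], for a decreasing sequence [b] of
    points of residue [0].  As elements of [H] flip nothing, the coset of
    [(u i)^-1] determines the set of points that [u i] flips. *)
Lemma conj_subgroup_index : infinite_index conj_subgroup.
Proof.
have [g [x [gB px gx]]] := flipping_element.
pose b i := tree_pt i.+1 n.-1.
have n1 i : (0 < n.-1 < N ^ i.+1)%N.
  apply/andP; split; first lia.
  apply: (@leq_trans (N ^ 1)); first by rewrite expn1 /arity; lia.
  by rewrite leq_exp2l.
have Bb i : residue0 (b i) by apply: residue0_tree_pt => //; rewrite modnn.
have b_lt i j : (i < j)%N -> b j < b i.
  move=> ij; rewrite /b -(tree_pt_refine n_gt1 i.+1 (j - i)) addSn subnKC ?(ltnW ij) //.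
  rewrite tree_pt_lt // -{1}[n.-1]muln1 ltn_pmul2l; last by case/andP: (n1 0%N).
  by rewrite -(expn0 N) ltn_exp2l // subn_gt0.
have kex i : exists u : F n, forall y, unit_adic y ->
    flip (\val u) y = (b i.+1 <= y < b 0%N).
  have [||||k kB kE] := @flips_on_all R n n_gt1 th th_inc thE (is_brown_thompson n)
    _ _ _ _ g x gB px gx _ _ (Bb i.+1) (Bb 0%N) (b_lt _ _ (ltn0Sn i)) => //.
  - exact: is_brown_thompsonM.
  - exact: is_brown_thompsonV.
  - exact: brown_thompson_conj.
  by have [u uE] := thompson_lift kB; exists u; rewrite uE.
have {kex}[u uE] := choice kex.
pose C i : set (F n) := [set ((u i)^-1 * h)%g | h in conj_subgroup].
have C_lt i j : (i < j)%N -> C i = C j -> False.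
  move=> ij CE; have : C i (u i)^-1%g.
    exists 1%g; last by rewrite mulg1.
    by have [] := conj_subgroup_closed; rewrite inE.
  rewrite CE => -[h /conj_subgroupP hH hE].
  have uj : u j = (h * u i)%g.
    by apply: (mulIg (u i)^-1%g); rewrite mulgK -hE mulgA mulgV mul1g.
  have pb := residue0_unit_adic (Bb j.+1); have := uE j _ pb.
  rewrite uj thompson_valM (flip_act n_gt1 thE) ?valP_thompson //; try exact: valP_thompson.
  rewrite hH ?uE //; last by apply: unit_adic_act => //; exact: valP_thompson.
  by rewrite lexx b_lt // leNgt b_lt.
have C_inj : injective C.
  by move=> i j CE; case: (ltngtP i j) => // [/C_lt/(_ CE)|/C_lt/(_ (esym CE))].
move=> /(finite_preimage (in2W C_inj)); apply: contra_not infinite_nat.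
by apply: sub_finite_set => i _; exists (u i)^-1%g.
Qed.

(** Points of residue [0] on both sides of [z = th^-1 x] are in one orbit of [F_N],
    and an increasing map that sends the left one to the right one moves [z]. *)
Lemma conj_subgroup_no_fixpoint :
  ~ (exists x : unit_itv R, 0 < \val x < 1 /\ fixes conj_subgroup x).
Proof.
move=> [x [/andP[x0 x1] xfix]]; have thVi := increasingV th_inc.
have xI := unit_itvP x; have I0 : 0 <= (0 : R) <= 1 by rewrite lexx ler01.
have I1 : 0 <= (1 : R) <= 1 by rewrite lexx ler01.
pose z := act th^-1%g (\val x); have zI : 0 <= z <= 1 := act_itv _ _.
have z0 : 0 < z by rewrite -(act_at0 thVi) act_ltE.
have z1 : z < 1 by rewrite -(act_at1 thVi) act_ltE.
have N1 : (0 < N.-1)%N by rewrite -ltnS prednK // ltnW.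
have [k [a [ak /andP[pz0 pz]]]] := adic_dense N_gt1 N1 (lexx 0) z0 (ltW z1).
have [l [c [cl /andP[zr zr1]]]] := adic_dense N_gt1 N1 (ltW z0) z1 (lexx 1).
have pI := @adic_itv R N N_gt1 _ _ (ltnW ak).
have rI := @adic_itv R N N_gt1 _ _ (ltnW cl).
have [||||f [fB fE _]] := @move_point R N N_gt1 0 1 (adic N k (N.-1 * a + 0))
  (adic N l (N.-1 * c + 0)) (lexx _) (lexx _) _ _ (Zinv0 N) (Zinv_one N).
- by rewrite pz0 (lt_trans pz).
- by rewrite zr1 (lt_trans z0).
- exact: Zinv_adic.
- apply/residueP => //; try exact: Zinv_adic.
  by rewrite !residue_adic // !addn0 !modnMr.
have [v vE] := thompson_lift fB.
have [u uE] := thompson_lift (brown_thompson_conj n_gt1 th_inc thE fB).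
have := xfix u; rewrite -[_ = _]/(_ = _) => /(_ _)/(congr1 val) H.
have : act (\val u) (\val x) = \val x by rewrite -act_val H //; exists v; rewrite uE vE.
rewrite uE !actM -/z => fz; have fi := brown_thompson_increasing fB.
have : act f z = z.
  by apply: (act_inj (f := th)) => //; [exact: act_itv|rewrite fz /z actVK].
have : adic N l (N.-1 * c + 0) < act f z by rewrite -fE act_ltE.
by move=> h1 h2; rewrite h2 in h1; have := lt_trans h1 zr; rewrite ltxx.
Qed.

Lemma conj_subgroup_isog : subgroup_isog conj_subgroup (F N).
Proof.
have phiB (f : F N) : brown_thompson_pred R n (th * \val f * th^-1)%g.
  exact/asboolT/(brown_thompson_conj n_gt1 th_inc thE)/valP_thompson.
pose phi (f : F N) : F n :=
  exist (fun g => brown_thompson_pred R n g) _ (phiB f).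
have phiM : {morph phi : f g / (f * g)%g}.
  move=> f g; apply: val_inj; rewrite thompson_valM.
  rewrite -[LHS]/(th * \val (f * g)%g * th^-1)%g thompson_valM.
  rewrite -[RHS]/((th * \val f * th^-1) * (th * \val g * th^-1))%g.
  by rewrite !mulgA mulgVK.
pose phi_mul := isMultiplicative.Build (F N) (F n) phi phiM.
pose phi_hom : {multiplicative F N -> F n} := HB.pack phi phi_mul.
exists phi_hom; split.
- by move=> f _ /=; exists f.
- move=> f g _ _ /(congr1 val) /= E; apply: val_inj.
  by move/mulIg: E => /mulgI.
- by move=> g [f fE]; exists f => //; apply: val_inj; rewrite fE.
Qed.

End JonesSubgroup.

Theorem theorem1p2 (R : realType) (n : nat) (n_ge2 : (2 <= n)%N) :
  exists H : set (brown_thompson R n),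
    [/\ maximal_subgroup H,
        infinite_index H,
        ~ (exists x : unit_itv R, 0 < \val x < 1 /\ fixes H x)
      & subgroup_isog H (brown_thompson R (2 * n - 1))].
Proof.
have [th [th_inc thE]] := subdivision_homeo (R := R) n_ge2.
exists (@conj_subgroup R n th); split.
- exact: conj_subgroup_maximal.
- exact: conj_subgroup_index.
- exact: conj_subgroup_no_fixpoint.
- exact: conj_subgroup_isog.
Qed.
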